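(* Let $F$ be a zippable set functor equipped with an encoding $(A,\flat)$ and a refinement interface $(W,\mathrm{init},\mathrm{update})$ with run time factor $p(c)$. Then the generic coalgebraic partition refinement algorithm (which starts from the partition of the state set induced by $F!\cdot c\colon C\to F1$, iteratively splits blocks, and accesses $F$ only through the encoding $\flat$, the values $F!(c(x))$, calls to $\mathrm{init}$ and $\mathrm{update}$, and comparisons of values in $F3$) computes the behavioural equivalence relation on an input $F$-coalgebra $c\colon C\to FC$ with $n$ states and $m$ edges in $\mathcal{O}((m+n)\cdot\log n\cdot p(c))$ steps.
   Context: A set functor $F$ assigns to each set $X$ a set $FX$ and to each map $f\colon X\to Y$ a map $Ff\colon FX\to FY$, preserving identities and composition. An $F$-coalgebra is a set $C$ with a map $c\colon C\to FC$; a morphism $h\colon (C,c)\to(D,d)$ is a map with $Fh\cdot c=d\cdot h$; states $x,y\in C$ are behaviourally equivalent if some coalgebra morphism $h$ has $h(x)=h(y)$. $\mathcal{B}_\omega X$ denotes the set of finite bags (finitely supported maps $X\to\mathbb{N}$) over $X$; $|\ell|$ is the size of a bag counted with multiplicity; $\{\!|\cdots|\!\}$ denotes multiset comprehension. Let $1=\{*\}$, $!\colon X\to 1$ the unique map, $3=\{0,1,2\}$, and for $S\subseteq B\subseteq X$ let $\chi_S^B\colon X\to 3$ send $x$ to $2$ if $x\in S$, to $1$ if $x\in B\setminus S$, and to $0$ otherwise. An encoding of $F$ is a set $A$ of labels with maps $\flat\colon FX\to\mathcal{B}_\omega(A\times X)$, one for each set $X$ (not required to be natural). A coalgebra $c\colon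 C\to FC$ has $n=|C|$ states and $m=\sum_{x\in C}|\flat(c(x))|$ edges. A refinement interface for $F$ (with respect to $(A,\flat)$) consists of a set $W$ of weights and functions $\mathrm{init}\colon F1\times\mathcal{B}_\omega A\to W$ and $\mathrm{update}\colon \mathcal{B}_\omega A\times W\to W\times F3\times W$ such that there exists a family of maps $w\colon \mathcal{P}X\to(FX\to W)$, one per set $X$, with $\mathrm{init}(F!(t),\{\!|a\mid (a,x)\in\flat(t)|\!\})=w(X)(t)$ and $\mathrm{update}(\{\!|a\mid (a,x)\in\flat(t),x\in S|\!\},w(B)(t))=(w(S)(t),F\chi_S^B(t),w(B\setminus S)(t))$ for all $t\in FX$ and $S\subseteq B\subseteq X$. The interface has run time factor $p(c)$ if for every map $c\colon X\to FY$: (1) for $x\in X$, $t=c(x)$, $S\subseteq B\subseteq Y$, the calls $\mathrm{init}(F!(t),\ell)$ with $\ell=\{\!|a\mid(a,y)\in\flat(t)|\!\}$ and $\mathrm{update}(\ell,w(B)(t))$ with $\ell=\{\!|a\mid (a,y)\in\flat(t),y\in S|\!\}$ run in time $\mathcal{O}(|\ell|\cdot p(c))$; and (2) equality of values in $\{F\chi_S^B(c(q))\mid q\in X, S\subseteq B\subseteq Y\}\subseteq F3$ can be checked in time $\mathcal{O}(p(c))$. $F$ is zippable if for all sets $X,Y$ the map $\langle F(X+!),F(!+Y)\rangle\colon F(X+Y)\to F(X+1)\times F(1+Y)$ is injective.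
   Formalization: Values in F3 are compared by a three-way comparison for a linear order in time O(p(c)), since equality tests alone force quadratically many tests; |ℓ| = 0 counts as 1, every call takes at least one step, and the time bound is for n ≥ 2 because log 1 = 0. *)

(* Defs.v *)
From HB Require Import structures.
From mathcomp Require Import all_boot all_order all_algebra.
Set Warnings "-notation-incompatible-prefix".
From mathcomp Require Import finmap multiset.
Set Warnings "notation-incompatible-prefix".
From mathcomp Require Import boolp classical_sets reals.

Set Implicit Arguments.
Unset Strict Implicit.
Unset Printing Implicit Defensive.

Import Order.TTheory GRing.Theory Num.Theory.

Local Open Scope classical_set_scope.

Record set_functor := SetFunctor {
  fobj :> Type -> Type;
  fmap : forall X Y : Type, (X -> Y) -> fobj X -> fobj Y;
  fmap_id : forall (X : Type) (t : fobj X), fmap (fun x => x) t = t;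
  fmap_comp : forall (X Y Z : Type) (g : Y -> Z) (f : X -> Y) (t : fobj X),
    fmap (fun x => g (f x)) t = fmap g (fmap f t)
}.

Definition bang (X : Type) : X -> unit := fun=> tt.

Definition sum_map (X X' Y Y' : Type) (f : X -> X') (g : Y -> Y')
    (z : X + Y) : X' + Y' :=
  match z with inl x => inl (f x) | inr y => inr (g y) end.

Definition zippable (F : set_functor) : Prop :=
  forall X Y : Type, injective (fun t : F (X + Y)%type =>
    (fmap (sum_map (fun x : X => x) (@bang Y)) t,
     fmap (sum_map (@bang X) (fun y : Y => y)) t)).

Definition coalg_morphism (F : set_functor) (C D : Type)
    (c : C -> F C) (d : D -> F D) (h : C -> D) : Prop :=
  forall x : C, fmap h (c x) = d (h x).

Definition behaviourally_equivalent (F : set_functor) (C : Type)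
    (c : C -> F C) (x y : C) : Prop :=
  exists (D : Type) (d : D -> F D) (h : C -> D),
    coalg_morphism c d h /\ h x = h y.

(* A multiset is a finitely supported map to nat; {classic T} is T with the
   choice structure given by the classical axioms. *)
Definition bag (T : Type) : Type := multiset {classic T}.

(* The elements of a bag, each repeated according to its multiplicity. *)
Definition elems (T : Type) (b : bag T) : seq T := @enum_mset {classic T} b.

Definition bag_size (T : Type) (b : bag T) : nat := size (elems b).

Definition bag_of (T : Type) (s : seq T) : bag T := @seq_mset {classic T} s.

Definition encoding (F : set_functor) (A : Type) : Type :=
  forall X : Type, F X -> bag (A * X).

(* The bag of all a with (a, x) in b. *)
Definition labels (A X : Type) (b : bag (A * X)) : bag A :=
  bag_of [seq e.1 | e <- elems b].

(* The bag of all a with (a, x) in b and x in S. *)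
Definition labels_into (A X : Type) (b : bag (A * X)) (S : set X) : bag A :=
  bag_of [seq e.1 | e <- elems b & `[< S e.2 >]].

Definition num_edges (F : set_functor) (A : Type) (flat : encoding F A)
    (C : finType) (c : C -> F C) : nat :=
  (\sum_(x : C) bag_size (flat C (c x)))%N.

Definition zero3 : 'I_3 := @Ordinal 3 0 isT.
Definition one3 : 'I_3 := @Ordinal 3 1 isT.
Definition two3 : 'I_3 := @Ordinal 3 2 isT.

Definition chi (X : Type) (S B : set X) (x : X) : 'I_3 :=
  if `[< S x >] then two3 else if `[< B x >] then one3 else zero3.

Definition weight_family (F : set_functor) (A : Type) (flat : encoding F A)
    (W : Type) (init : F unit -> bag A -> W)
    (update : bag A -> W -> W * F 'I_3 * W)
    (w : forall X : Type, set X -> F X -> W) : Prop :=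
  forall (X : Type) (t : F X),
    init (fmap (@bang X) t) (labels (flat X t)) = w X setT t /\
    forall S B : set X, S `<=` B ->
      update (labels_into (flat X t) S) (w X B t) =
        (w X S t, fmap (chi S B) t, w X (B `\` S) t).

Record refinement_interface (F : set_functor) (A : Type)
    (flat : encoding F A) := RefinementInterface {
  weight : Type;
  init : F unit -> bag A -> weight;
  update : bag A -> weight -> weight * F 'I_3 * weight;
  weight_familyP : exists w, weight_family flat init update w
}.

(* How long the calls to an interface take.  Values of F 3 are compared, and
   in particular tested for equality, by a three-way comparison [cmp3] for
   some linear order (e.g. the order of their representations): the algorithm
   groups states by their values, which is impossible in less than a
   quadratic number of tests if only the outcome of equality tests is known. *)
Record implementation (F : set_functor) (A : Type) (flat : encoding F A)
    (I : refinement_interface flat) := Implementation {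
  cmp3 : F 'I_3 -> F 'I_3 -> comparison;
  cmp3_eq : forall u v, cmp3 u v = Eq <-> u = v;
  cmp3_sym : forall u v, cmp3 v u = CompOpp (cmp3 u v);
  cmp3_trans : forall u v w, cmp3 u v = Lt -> cmp3 v w = Lt -> cmp3 u w = Lt;
  time_init : F unit -> bag A -> nat;
  time_update : bag A -> weight I -> nat;
  time_cmp3 : F 'I_3 -> F 'I_3 -> nat;
  time_init_gt0 : forall v l, (0 < time_init v l)%N;
  time_update_gt0 : forall l w, (0 < time_update l w)%N;
  time_cmp3_gt0 : forall u v, (0 < time_cmp3 u v)%N
}.

Definition observations (F : set_functor) (X Y : Type) (c : X -> F Y) :
    set (F 'I_3) :=
  [set v | exists (q : X) (S B : set Y), S `<=` B /\ v = fmap (chi S B) (c q)].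

(* The length of an empty bag counts as 1, since no call takes no time. *)
Definition has_run_time_factor (R : realType) (F : set_functor) (A : Type)
    (flat : encoding F A) (I : refinement_interface flat)
    (M : implementation I) (p : forall X Y : Type, (X -> F Y) -> R) : Prop :=
  exists2 K : R, (0 < K)%R &
  forall (X Y : Type) (c : X -> F Y)
         (w : forall Z : Type, set Z -> F Z -> weight I),
    weight_family flat (@init _ _ _ I) (@update _ _ _ I) w ->
  [/\ forall x : X,
        let t := c x in let l := labels (flat Y t) in
        ((time_init M (fmap (@bang Y) t) l)%:R
           <= K * ((maxn 1 (bag_size l))%:R * p X Y c))%R,
      forall (x : X) (S B : set Y), S `<=` B ->
        let t := c x in let l := labels_into (flat Y t) S in
        ((time_update M l (w Y B t))%:R
           <= K * ((maxn 1 (bag_size l))%:R * p X Y c))%R &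
      forall u v : F 'I_3, observations c u -> observations c v ->
        ((time_cmp3 M u v)%:R <= K * p X Y c)%R].

(* A program maps an initial memory to a value, a final memory and the number
   of steps taken.  Reading or writing a variable or an array entry takes one
   step; lists are linked lists that store their length. *)
Definition prog (St T : Type) : Type := St -> T * St * nat.

Section Programs.
Context {St T U : Type}.

Definition ret (x : T) : prog St T := fun s => (x, s, 0%N).

Definition bind (e : prog St T) (f : T -> prog St U) : prog St U := fun s =>
  let: (x, s1, k1) := e s in let: (y, s2, k2) := f x s1 in (y, s2, (k1 + k2)%N).

Definition read (f : St -> T) : prog St T := fun s => (f s, s, 1%N).

(* A call of an external function that takes k steps and returns x. *)
Definition call (k : nat) (x : T) : prog St T := fun s => (x, s, k).

End Programs.

Definition write (St : Type) (g : St -> St) : prog St unit :=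
  fun s => (tt, g s, 1%N).

Notation "'let*' x := e 'in' f" := (bind e (fun x => f))
  (at level 200, x name, e at level 200, f at level 200).
Notation "e1 ;;; e2" := (bind e1 (fun _ : unit => e2))
  (at level 110, right associativity).

Definition when (St : Type) (b : bool) (e : prog St unit) : prog St unit :=
  if b then e else ret tt.

Fixpoint for_each (St T : Type) (s : seq T) (f : T -> prog St unit) :
    prog St unit :=
  if s is x :: s' then call 1 tt ;;; f x ;;; for_each s' f else ret tt.

(* Runs f on each element of s and collects the results other than None. *)
Fixpoint collect (St T U : Type) (s : seq T) (f : T -> prog St (option U)) :
    prog St (seq U) :=
  if s is x :: s' then
    call 1 tt ;;;
    let* o := f x in
    let* r := collect s' f in
    ret (if o is Some y then y :: r else r)
  else ret [::].

(* [while_run b e s s' k]: the loop "while b do e", started in memory s,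
   terminates in memory s' after k steps. *)
Inductive while_run (St : Type) (b : St -> bool) (e : prog St unit) :
    St -> St -> nat -> Prop :=
| WhileDone s : ~~ b s -> while_run b e s s 1
| WhileStep s s1 s' k1 k : b s -> e s = (tt, s1, k1) ->
    while_run b e s1 s' k -> while_run b e s s' (1 + k1 + k)%N.

Definition set_at (K : eqType) (V : Type) (a : K -> V) (i : K) (v : V) :
    K -> V :=
  fun j => if j == i then v else a j.

Record edge (A C : Type) := Edge {
  edge_id : nat;
  edge_src : C;
  edge_lab : A;
  edge_tgt : C
}.

(* Two partitions of the state set C are maintained: a partition P and a
   coarser partition Q.  Blocks are named by natural numbers, and a block of Q
   is represented by the list of the blocks of P it consists of.  Weights are
   stored in memory cells, also named by natural numbers: all edges from x
   into a block B of Q have the same cell, which contains w(B)(c(x)). *)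
Record memory (F : set_functor) (A W C : Type) := Memory {
  pnum : nat;                           (* number of blocks of P *)
  pblk : C -> nat;                      (* block of P of a state *)
  pmem : nat -> seq C;                  (* states of a block of P *)
  qnum : nat;                           (* number of blocks of Q *)
  qblk : nat -> nat;                    (* block of Q of a block of P *)
  qmem : nat -> seq nat;                (* blocks of P in a block of Q *)
  work : seq nat;                       (* blocks of Q that are not in P *)
  pred_edges : C -> seq (edge A C);     (* edges into a state *)
  to_sub : C -> seq (edge A C);         (* edges from a state into S *)
  last_w : nat -> nat;                  (* cell of an edge *)
  cnum : nat;                           (* number of cells *)
  cell : nat -> option W;               (* contents of a cell *)
  mark : nat -> seq (C * nat);          (* marked states of a block of P,
                                           with the cell of their edges *)
  touched : seq (nat * F 'I_3)          (* blocks with marked states *)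
}.

Section Setters.
Context {F : set_functor} {A W : Type} {C : finType}.
Local Notation memory := (memory F A W C).

Definition set_pnum v (s : memory) : memory :=
  let: Memory _ a2 a3 a4 a5 a6 a7 a8 a9 a10 a11 a12 a13 a14 := s in
  Memory v a2 a3 a4 a5 a6 a7 a8 a9 a10 a11 a12 a13 a14.
Definition set_pblk v (s : memory) : memory :=
  let: Memory a1 _ a3 a4 a5 a6 a7 a8 a9 a10 a11 a12 a13 a14 := s in
  Memory a1 v a3 a4 a5 a6 a7 a8 a9 a10 a11 a12 a13 a14.
Definition set_pmem v (s : memory) : memory :=
  let: Memory a1 a2 _ a4 a5 a6 a7 a8 a9 a10 a11 a12 a13 a14 := s in
  Memory a1 a2 v a4 a5 a6 a7 a8 a9 a10 a11 a12 a13 a14.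
Definition set_qnum v (s : memory) : memory :=
  let: Memory a1 a2 a3 _ a5 a6 a7 a8 a9 a10 a11 a12 a13 a14 := s in
  Memory a1 a2 a3 v a5 a6 a7 a8 a9 a10 a11 a12 a13 a14.
Definition set_qblk v (s : memory) : memory :=
  let: Memory a1 a2 a3 a4 _ a6 a7 a8 a9 a10 a11 a12 a13 a14 := s in
  Memory a1 a2 a3 a4 v a6 a7 a8 a9 a10 a11 a12 a13 a14.
Definition set_qmem v (s : memory) : memory :=
  let: Memory a1 a2 a3 a4 a5 _ a7 a8 a9 a10 a11 a12 a13 a14 := s in
  Memory a1 a2 a3 a4 a5 v a7 a8 a9 a10 a11 a12 a13 a14.
Definition set_work v (s : memory) : memory :=
  let: Memory a1 a2 a3 a4 a5 a6 _ a8 a9 a10 a11 a12 a13 a14 := s in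
  Memory a1 a2 a3 a4 a5 a6 v a8 a9 a10 a11 a12 a13 a14.
Definition set_pred_edges v (s : memory) : memory :=
  let: Memory a1 a2 a3 a4 a5 a6 a7 _ a9 a10 a11 a12 a13 a14 := s in
  Memory a1 a2 a3 a4 a5 a6 a7 v a9 a10 a11 a12 a13 a14.
Definition set_to_sub v (s : memory) : memory :=
  let: Memory a1 a2 a3 a4 a5 a6 a7 a8 _ a10 a11 a12 a13 a14 := s in
  Memory a1 a2 a3 a4 a5 a6 a7 a8 v a10 a11 a12 a13 a14.
Definition set_last_w v (s : memory) : memory :=
  let: Memory a1 a2 a3 a4 a5 a6 a7 a8 a9 _ a11 a12 a13 a14 := s in
  Memory a1 a2 a3 a4 a5 a6 a7 a8 a9 v a11 a12 a13 a14.
Definition set_cnum v (s : memory) : memory :=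
  let: Memory a1 a2 a3 a4 a5 a6 a7 a8 a9 a10 _ a12 a13 a14 := s in
  Memory a1 a2 a3 a4 a5 a6 a7 a8 a9 a10 v a12 a13 a14.
Definition set_cell v (s : memory) : memory :=
  let: Memory a1 a2 a3 a4 a5 a6 a7 a8 a9 a10 a11 _ a13 a14 := s in
  Memory a1 a2 a3 a4 a5 a6 a7 a8 a9 a10 a11 v a13 a14.
Definition set_mark v (s : memory) : memory :=
  let: Memory a1 a2 a3 a4 a5 a6 a7 a8 a9 a10 a11 a12 _ a14 := s in
  Memory a1 a2 a3 a4 a5 a6 a7 a8 a9 a10 a11 a12 v a14.
Definition set_touched v (s : memory) : memory :=
  let: Memory a1 a2 a3 a4 a5 a6 a7 a8 a9 a10 a11 a12 a13 _ := s in
  Memory a1 a2 a3 a4 a5 a6 a7 a8 a9 a10 a11 a12 a13 v.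

Definition put_pblk x b : prog memory unit :=
  write (fun s => set_pblk (set_at (pblk s) x b) s).
Definition put_pmem b l : prog memory unit :=
  write (fun s => set_pmem (set_at (pmem s) b l) s).
Definition put_qblk b q : prog memory unit :=
  write (fun s => set_qblk (set_at (qblk s) b q) s).
Definition put_qmem q l : prog memory unit :=
  write (fun s => set_qmem (set_at (qmem s) q l) s).
Definition put_pred_edges x l : prog memory unit :=
  write (fun s => set_pred_edges (set_at (pred_edges s) x l) s).
Definition put_to_sub x l : prog memory unit :=
  write (fun s => set_to_sub (set_at (to_sub s) x l) s).
Definition put_last_w (e : edge A C) i : prog memory unit :=
  write (fun s => set_last_w (set_at (last_w s) (edge_id e) i) s).
Definition put_cell i w : prog memory unit :=
  write (fun s => set_cell (set_at (cell s) i (Some w)) s).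
Definition put_mark b l : prog memory unit :=
  write (fun s => set_mark (set_at (mark s) b l) s).

Definition empty_memory : memory :=
  Memory 0 (fun=> 0%N) (fun=> [::]) 0 (fun=> 0%N) (fun=> [::]) [::]
         (fun=> [::]) (fun=> [::]) (fun=> 0%N) 0 (fun=> None) (fun=> [::]) [::].

End Setters.

Section Algorithm.
Context {F : set_functor} {A : Type} {flat : encoding F A}.
Context {I : refinement_interface flat} (M : implementation I).
Context {C : finType} (c : C -> F C).

Local Notation store := (memory F A (weight I) C).
Local Notation group := (F 'I_3 * seq C)%type.

(* Merging two lists of groups sorted by their values; groups with the same
   value are united.  The lists are linked lists, so that the concatenation
   and the rest of a list when the other one is exhausted take one step. *)
Fixpoint merge_groups (g1 : seq group) : seq group -> seq group * nat :=
  match g1 with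
  | [::] => fun g2 => (g2, 1%N)
  | (u, xs) :: g1' => fix merge_aux (g2 : seq group) : seq group * nat :=
      match g2 with
      | [::] => (g1, 1%N)
      | (v, ys) :: g2' =>
          let k := (1 + time_cmp3 M u v)%N in
          match cmp3 M u v with
          | Lt => let: (r, k') := merge_groups g1' g2 in
                  ((u, xs) :: r, (k + k')%N)
          | Eq => let: (r, k') := merge_groups g1' g2' in
                  ((u, xs ++ ys) :: r, (k + k')%N)
          | Gt => let: (r, k') := merge_aux g2' in
                  ((v, ys) :: r, (k + k')%N)
          end
      end
  end.

Fixpoint merge_pass (gs : seq (seq group)) : seq (seq group) * nat :=
  match gs with
  | g1 :: g2 :: gs' =>
      let: (g, k) := merge_groups g1 g2 in
      let: (r, k') := merge_pass gs' in (g :: r, (1 + k + k')%N)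
  | _ => (gs, 1%N)
  end.

(* Every pass halves the length of gs, so d = size gs is large enough. *)
Fixpoint merge_passes (d : nat) (gs : seq (seq group)) : seq group * nat :=
  match d, gs with
  | d'.+1, _ :: _ :: _ =>
      let: (gs', k) := merge_pass gs in
      let: (r, k') := merge_passes d' gs' in (r, (1 + k + k')%N)
  | _, _ => (flatten gs, 1%N)
  end.

Definition group_by (s : seq (F 'I_3 * C)) : prog store (seq group) :=
  let: (r, k) :=
    merge_passes (size s) [seq [:: (vx.1, [:: vx.2])] | vx <- s] in
  call (size s + k) r.

Definition label_bag (es : seq (edge A C)) : bag A :=
  bag_of [seq edge_lab e | e <- es].

Definition call_init (v : F unit) (es : seq (edge A C)) : prog store (weight I) :=
  let l := label_bag es in call (size es + time_init M v l) (init I v l).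

Definition call_update (es : seq (edge A C)) (w : weight I) :
    prog store (weight I * F 'I_3 * weight I) :=
  let l := label_bag es in call (size es + time_update M l w) (update l w).

Definition call_cmp3 (u v : F 'I_3) : prog store comparison :=
  call (time_cmp3 M u v) (cmp3 M u v).

Definition new_cell (w : weight I) : prog store nat :=
  let* i := read (@cnum _ _ _ _) in
  write (set_cnum i.+1) ;;; put_cell i w ;;; ret i.

Definition type_of (x : C) : F unit := fmap (@bang C) (c x).

(* F 1 embeds into F 3 along the constant map with value 0, which maps
   type_of x to fmap (chi set0 set0) (c x). *)
Definition type3 (x : C) : F 'I_3 := fmap (fun=> zero3) (type_of x).

Definition edges : seq (edge A C) :=
  let es := [seq (x, e) | x <- enum C, e <- elems (flat (c x))] in
  [seq Edge ie.1 ie.2.1 ie.2.2.1 ie.2.2.2 | ie <- zip (iota 0 (size es)) es].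

Definition add_edge (e : edge A C) : prog store unit :=
  let* es := read (fun s => to_sub s (edge_src e)) in
  put_to_sub (edge_src e) (e :: es) ;;;
  let* ps := read (fun s => pred_edges s (edge_tgt e)) in
  put_pred_edges (edge_tgt e) (e :: ps).

Definition init_weights (x : C) : prog store unit :=
  let* es := read (fun s => to_sub s x) in
  let* w := call_init (type_of x) es in
  let* i := new_cell w in
  for_each es (fun e => put_last_w e i) ;;;
  put_to_sub x [::].

(* A new block of P, in the block q of Q and consisting of the states xs. *)
Definition new_block (q : nat) (xs : seq C) : prog store unit :=
  let* i := read (@pnum _ _ _ _) in
  write (set_pnum i.+1) ;;;
  put_pmem i xs ;;;
  for_each xs (fun x => put_pblk x i) ;;;
  put_qblk i q ;;;
  let* bs := read (fun s => qmem s q) in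
  put_qmem q (i :: bs) ;;;
  when (size bs == 1%N)
    (let* wk := read (@work _ _ _ _) in write (set_work (q :: wk))).

Definition initialize : prog store unit :=
  for_each edges add_edge ;;;
  for_each (enum C) init_weights ;;;
  let* vs := collect (enum C) (fun x => ret (Some (type3 x, x))) in
  let* gs := group_by vs in
  write (set_qnum 1) ;;;
  for_each gs (fun g => new_block 0 g.2).

(* In [visit_edge] and [update_state], the cell i is never empty (None). *)
Definition visit_edge (e : edge A C) : prog store unit :=
  let x := edge_src e in
  let* b := read (fun s => pblk s x) in
  let* mk := read (fun s => mark s b) in
  let* i := read (fun s => last_w s (edge_id e)) in
  when (nilp mk)
    (let* ow := read (fun s => cell s i) in
     if ow is Some w then
       let* r := call_update [::] w in
       let* td := read (@touched _ _ _ _) in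
       write (set_touched ((b, r.1.2) :: td))
     else ret tt) ;;;
  let* es := read (fun s => to_sub s x) in
  when (nilp es) (put_mark b ((x, i) :: mk)) ;;;
  put_to_sub x (e :: es).

(* Updates the weights of the marked state x and returns (v, x), where
   v = F chi_S^B (c x), unless v is the value v0 of the unmarked states. *)
Definition update_state (v0 : F 'I_3) (xi : C * nat) :
    prog store (option (F 'I_3 * C)) :=
  let: (x, i) := xi in
  let* es := read (fun s => to_sub s x) in
  put_to_sub x [::] ;;;
  let* ow := read (fun s => cell s i) in
  if ow is Some w then
    let* r := call_update es w in
    put_cell i r.2 ;;;
    let* j := new_cell r.1.1 in
    for_each es (fun e => put_last_w e j) ;;;
    let* o := call_cmp3 r.1.2 v0 in
    ret (if o is Eq then None else Some (r.1.2, x))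
  else ret None.

(* Moves the states xs of the block b of P to a new block.  The lists pmem are
   doubly linked, so that a state is removed in one step. *)
Definition split_off (b : nat) (xs : seq C) : prog store unit :=
  for_each xs (fun x =>
    let* ys := read (fun s => pmem s b) in put_pmem b (rem x ys)) ;;;
  let* q := read (fun s => qblk s b) in
  new_block q xs.

Definition regroup (bv : nat * F 'I_3) : prog store unit :=
  let: (b, v0) := bv in
  let* mk := read (fun s => mark s b) in
  put_mark b [::] ;;;
  let* vs := collect mk (update_state v0) in
  let* gs := group_by vs in
  let* sz := read (fun s => size (pmem s b)) in
  (* if no state of b has value v0, then the first group remains in b *)
  let rest := if size vs == sz then behead gs else gs in
  for_each rest (fun g => split_off b g.2).

(* P is refined by the kernel of F chi_S^B . c, where S is the block b of P
   and B was the block of Q containing b. *)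
Definition refine_by (b : nat) : prog store unit :=
  let* ys := read (fun s => pmem s b) in
  for_each ys (fun y =>
    let* es := read (fun s => pred_edges s y) in for_each es visit_edge) ;;;
  let* td := read (@touched _ _ _ _) in
  write (set_touched [::]) ;;;
  for_each td regroup.

(* Picks a block B of Q and a block S of P with S a proper subset of B and
   2|S| <= |B|, namely the smaller one of two blocks of P in B; replaces B by S
   and B \ S in Q; and refines P accordingly. *)
Definition refine_step : prog store unit :=
  let* wk := read (@work _ _ _ _) in
  if wk is q :: wk' then
    let* bs := read (fun s => qmem s q) in
    if bs is b1 :: b2 :: bs' then
      let* n1 := read (fun s => size (pmem s b1)) in
      let* n2 := read (fun s => size (pmem s b2)) in
      let: (b, b') := if (n1 <= n2)%N then (b1, b2) else (b2, b1) in
      put_qmem q (b' :: bs') ;;;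
      let* q' := read (@qnum _ _ _ _) in
      write (set_qnum q'.+1) ;;;
      put_qmem q' [:: b] ;;;
      put_qblk b q' ;;;
      when (nilp bs') (write (set_work wk')) ;;;
      refine_by b
    else write (set_work wk')
  else ret tt.

(* The algorithm terminates on c after k steps; two states x, y are in the
   same block of the computed partition iff P x = P y. *)
Definition partition_refinement (P : C -> nat) (k : nat) : Prop :=
  exists (s s' : store) (k1 k2 : nat),
    [/\ initialize empty_memory = (tt, s, k1),
        while_run (fun s => ~~ nilp (work s)) refine_step s s' k2,
        P = pblk s' & k = (k1 + k2)%N].

End Algorithm.

(* Main.v *)
Require Import Defs.
From mathcomp Require Import all_boot all_order all_algebra.
From mathcomp Require Import reals exp.
From mathcomp Require Import finmap multiset boolp classical_sets.
From mathcomp Require Import zify ring.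

Set Implicit Arguments.
Unset Strict Implicit.
Unset Printing Implicit Defensive.

(** The loop maintains that P is coarser than behavioural equivalence and that
    states in one block of P have the same image under [F f . c], where [f] is
    the quotient map of Q.  Replacing a block [B] of Q by [S] and [B \ S] keeps
    the latter because P is refined by the kernel of [F chi_S^B . c] and [F] is
    zippable; the former because [chi_S^B] is constant on the blocks of P and
    hence factors through every coalgebra morphism.  When Q = P, the blocks of
    P form a quotient coalgebra.

    The running time is paid for by two potentials.  An edge is visited only
    when its target moves to a block of Q of at most half the size, so the sum
    of [log |Q-block of y|] over all states [y], weighted by one plus the
    in-degree, pays for all calls to the interface.  Grouping [n] states into
    classes of sizes [n_i] by a merge sort that unites equal values costs only
    [O(n + sum_i n_i log (n / n_i))] comparisons.  The second term is at most
    the decrease of the sum of [log |P-block of x|] over all states [x]. *)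

Local Notation tl := (trunc_log 2).

(** * Weakest preconditions *)

Definition wp (St T : Type) (e : prog St T) (Q : T -> St -> nat -> Prop)
    (s : St) : Prop :=
  let: (x, s', k) := e s in Q x s' k.

Section WeakestPreconditions.
Context {St T U : Type}.
Implicit Types (s : St) (e : prog St T).

Lemma wpP e Q s : wp e Q s -> exists x s' k, e s = (x, s', k) /\ Q x s' k.
Proof. by rewrite /wp; case: (e s) => -[x s'] k; exists x, s', k. Qed.

Lemma wp_of_eq e Q s x s' k : e s = (x, s', k) -> Q x s' k -> wp e Q s.
Proof. by rewrite /wp => ->. Qed.

Lemma wp_conseq e (Q Q' : T -> St -> nat -> Prop) s :
  (forall x s' k, Q x s' k -> Q' x s' k) -> wp e Q s -> wp e Q' s.
Proof. by move=> QQ'; rewrite /wp; case: (e s) => -[x s'] k; apply: QQ'. Qed.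

Lemma wp_ret (x : T) Q s : Q x s 0 -> wp (ret x) Q s.
Proof. by []. Qed.

Lemma wp_read (f : St -> T) Q s : Q (f s) s 1 -> wp (read f) Q s.
Proof. by []. Qed.

Lemma wp_call n (x : T) Q s : Q x s n -> wp (call n x) Q s.
Proof. by []. Qed.

Lemma wp_write (g : St -> St) Q s : Q tt (g s) 1 -> wp (write g) Q s.
Proof. by []. Qed.

Lemma wp_when (b : bool) (e : prog St unit) Q s :
  (b -> wp e Q s) -> (~~ b -> Q tt s 0) -> wp (when b e) Q s.
Proof. by case: b => wp_e Q_skip; [apply: wp_e|apply: Q_skip]. Qed.

Lemma wp_bind e (f : T -> prog St U) Q s :
  wp e (fun x s1 k1 => wp (f x) (fun y s2 k2 => Q y s2 (k1 + k2)) s1) s ->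
  wp (bind e f) Q s.
Proof.
rewrite /wp /bind; case: (e s) => -[x s1] k1.
by case: (f x s1) => -[y s2] k2.
Qed.

End WeakestPreconditions.

Ltac wp_run := repeat lazymatch goal with
  | |- wp (bind _ _) _ _ => apply: wp_bind
  | |- wp _ _ _ =>
    first [apply: wp_read | apply: wp_write | apply: wp_call | apply: wp_ret]
  end.

Section Loops.
Context {St T U : Type}.
Implicit Types (l : seq T) (s : St).

Lemma wp_for_each l (f : T -> prog St unit)
    (Inv : seq T -> St -> nat -> Prop) s :
  Inv [::] s 0 ->
  (forall done x todo s k, l = done ++ x :: todo -> Inv done s k ->
    wp (f x) (fun _ s' k' => Inv (rcons done x) s' (k + (1 + k'))) s) ->
  wp (for_each l f) (fun _ s' k => Inv l s' k) s.
Proof.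
move=> Inv0 InvS.
suff gen todo done s1 k : l = done ++ todo -> Inv done s1 k ->
  wp (for_each todo f) (fun _ s' k' => Inv l s' (k + k')) s1.
  exact: (gen l [::] s 0).
elim: todo done s1 k => [|x todo IH] done s1 k El Inv_k /=.
  by apply: wp_ret; rewrite addn0 El cats0.
wp_run; apply: wp_conseq (InvS _ _ _ _ _ El Inv_k) => _ s2 k2 Inv_k2.
apply: wp_conseq (IH (rcons done x) s2 _ _ Inv_k2) => [_ s3 k3|].
  by rewrite -!addnA.
by rewrite cat_rcons.
Qed.

Lemma wp_collect l (f : T -> prog St (option U))
    (Inv : seq T -> seq U -> St -> nat -> Prop) s :
  Inv [::] [::] s 0 ->
  (forall done x todo r s k, l = done ++ x :: todo -> Inv done r s k ->
    wp (f x) (fun o s' k' =>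
      Inv (rcons done x) (if o is Some y then rcons r y else r) s'
          (k + (1 + k'))) s) ->
  wp (collect l f) (fun r s' k => Inv l r s' k) s.
Proof.
move=> Inv0 InvS.
suff gen todo done r s1 k : l = done ++ todo -> Inv done r s1 k ->
  wp (collect todo f) (fun r' s' k' => Inv l (r ++ r') s' (k + k')) s1.
  exact: (gen l [::] [::] s 0).
elim: todo done r s1 k => [|x todo IH] done r s1 k El Inv_k /=.
  by apply: wp_ret; rewrite addn0 cats0 El cats0.
wp_run; apply: wp_conseq (InvS _ _ _ _ _ _ El Inv_k) => o s2 k2 Inv_k2.
wp_run; apply: wp_conseq (IH (rcons done x) _ s2 _ _ Inv_k2).
  move=> r3 s3 k3; rewrite /wp /=; case: o {Inv_k2} => [y|]; rewrite ?cat_rcons;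
  by rewrite addn0 -!addnA.
by rewrite cat_rcons.
Qed.

Lemma for_each_iter l (f : T -> prog St unit) (g : seq T -> St) n :
  (forall done x, f x (g done) = (tt, g (rcons done x), n)) ->
  for_each l f (g [::]) = (tt, g l, n.+1 * size l).
Proof.
move=> fg.
suff gen todo done :
  for_each todo f (g done) = (tt, g (done ++ todo), n.+1 * size todo)
    by apply: gen.
elim: todo done => [|x todo IH] done /=; first by rewrite cats0 muln0.
by rewrite /bind /= fg IH cat_rcons mulnS addnA add1n.
Qed.

Lemma collect_pure l (h : T -> U) s :
  collect l (fun x => ret (Some (h x))) s = ([seq h x | x <- l], s, size l).
Proof. by elim: l => //= x l IH; rewrite /bind /= IH addn0. Qed.

End Loops.

(** * Sequences *)

Section Fibers.
Context {T K : eqType} (f : T -> K).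
Implicit Types (l : seq T) (ys : seq K).

Lemma uniq_map_inj l : uniq [seq f x | x <- l] -> {in l &, injective f}.
Proof.
elim: l => //= x l IH /andP[fx_l /IH inj_l] y z; rewrite !inE.
case/predU1P=> [->|yl] /predU1P[->|zl] // fyz; last exact: inj_l.
  by rewrite fyz map_f in fx_l.
by rewrite -fyz map_f in fx_l.
Qed.

Lemma perm_flatten_fibers ys l : uniq ys ->
  perm_eq (flatten [seq [seq x <- l | f x == y] | y <- ys])
    [seq x <- l | f x \in ys].
Proof.
elim: ys => [_|y ys IH /andP[y_ys uniq_ys]] /=; first by rewrite filter_pred0.
rewrite perm_sym -(perm_filterC (fun x => f x == y)) -!filter_predI.
apply: perm_cat; last rewrite perm_sym (perm_trans (IH uniq_ys)) //.
  by rewrite (eq_filter (a2 := fun x => f x == y)) // => x /=; rewrite inE;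
    case: eqP.
apply/permP => p; congr count; apply: eq_filter => x /=; rewrite inE.
by case: eqP => // ->; rewrite (negPf y_ys).
Qed.

End Fibers.

Lemma uniq_notin_prefix (T : eqType) (s1 s2 : seq T) x :
  uniq (s1 ++ x :: s2) -> x \notin s1.
Proof. by rewrite uniq_catC /= mem_cat negb_or => /andP[/andP[]]. Qed.

Lemma sum_size_fibers (T : eqType) (K : finType) (f : T -> K) (l : seq T) :
  \sum_y size [seq x <- l | f x == y] = size l.
Proof.
have /perm_size := perm_flatten_fibers f l (enum_uniq K).
rewrite size_flatten sumnE !big_map -big_enum /= => ->.
by congr size; apply/all_filterP/allP => x _; rewrite mem_enum.
Qed.

Lemma sum_count_mem (K : eqType) (s l : seq K) :
  uniq s -> {subset l <= s} -> \sum_(v <- s) count_mem v l = size l.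
Proof.
move=> uniq_s /allP ls; have /perm_size := perm_flatten_fibers id l uniq_s.
rewrite size_flatten sumnE !big_map (all_filterP ls) => <-.
by apply: eq_bigr => v _; rewrite size_filter.
Qed.

(** * Lists of groups *)

Section Groups.
Context {V C : eqType}.
Local Notation group := (V * seq C)%type.
Implicit Types (g r : seq group) (h : group) (val : C -> V) (X : {pred C}).

Definition keys g : seq V := [seq h.1 | h <- g].

Definition states g : seq C := flatten [seq h.2 | h <- g].

Definition pairs g : seq (V * C) :=
  flatten [seq [seq (h.1, x) | x <- h.2] | h <- g].

Lemma pairs_cat g1 g2 : pairs (g1 ++ g2) = pairs g1 ++ pairs g2.
Proof. by rewrite /pairs map_cat flatten_cat. Qed.

Lemma map_snd_pairs g : [seq p.2 | p <- pairs g] = states g.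
Proof.
rewrite /pairs map_flatten -map_comp; congr flatten; apply: eq_map => h /=.
by rewrite -map_comp map_id.
Qed.

Lemma mem_pairs g v x :
  reflect (exists2 h, h \in g & h.1 = v /\ x \in h.2) ((v, x) \in pairs g).
Proof.
apply: (iffP flatten_mapP) => -[h hg].
  by case/mapP=> y yh [-> ->]; exists h.
by case=> <- xh; exists h => //; apply: map_f.
Qed.

Lemma pairs_keys g v x : (v, x) \in pairs g -> v \in keys g.
Proof. by case/mem_pairs=> h hg [<- _]; apply: map_f. Qed.

Lemma mem_states g x :
  reflect (exists2 h, h \in g & x \in h.2) (x \in states g).
Proof. exact: flatten_mapP. Qed.

Lemma states_cat g1 g2 : states (g1 ++ g2) = states g1 ++ states g2.
Proof. by rewrite /states map_cat flatten_cat. Qed.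

Lemma states_rcons g h : states (rcons g h) = states g ++ h.2.
Proof. by rewrite /states map_rcons flatten_rcons. Qed.

Lemma size_states g : size (states g) = \sum_(h <- g) size h.2.
Proof. by rewrite /states size_flatten sumnE !big_map. Qed.

Definition entropy g : nat :=
  \sum_(h <- g) size h.2 * (tl (size (states g)) - tl (size h.2)).

Lemma mem_group_pairs g h x :
  uniq (keys g) -> h \in g -> (x \in h.2) = ((h.1, x) \in pairs g).
Proof.
move=> uniq_g hg; apply/idP/mem_pairs => [xh|[h' h'g [hh' xh']]];
  first by exists h.
by rewrite -(uniq_map_inj uniq_g h'g hg hh').
Qed.

Lemma count_pairs g v :
  count (fun p => p.1 == v) (pairs g) = \sum_(h <- g | h.1 == v) size h.2.
Proof.
rewrite count_flatten -map_comp sumnE big_map [RHS]big_mkcond.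
apply: eq_bigr => h _ /=; rewrite count_map; case: ifP => h_v.
  by rewrite (eq_count (a2 := predT)) ?count_predT // => x; rewrite /= h_v.
by rewrite (eq_count (a2 := pred0)) ?count_pred0 // => x; rewrite /= h_v.
Qed.

Lemma count_pairs_group g h :
  uniq (keys g) -> h \in g -> count (fun p => p.1 == h.1) (pairs g) = size h.2.
Proof.
move=> uniq_g hg; rewrite count_pairs big_mkcond (bigD1_seq h)
  ?(map_uniq uniq_g) //=.
rewrite eqxx big_seq_cond big1 ?addn0 // => h' /andP[h'g].
apply: contraNeq; case: ifP => [/eqP hh' _|//].
by rewrite (uniq_map_inj uniq_g h'g hg hh') eqxx.
Qed.

(* The groups are classes of [val] on [X], but not necessarily all of them. *)
Record classes_of val X r : Prop := ClassesOf {
  classes_keys_uniq : uniq (keys r);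
  class_uniq : forall h, h \in r -> uniq h.2;
  class_nonempty : forall h, h \in r -> ~~ nilp h.2;
  mem_class : forall h x, h \in r -> (x \in h.2) = (x \in X) && (val x == h.1)
}.

Lemma classes_of_pairs val (xs : seq C) r :
  uniq xs -> uniq (keys r) -> {in r, forall h, ~~ nilp h.2} ->
  perm_eq (pairs r) [seq (val x, x) | x <- xs] -> classes_of val [in xs] r.
Proof.
move=> uniq_xs uniq_r r_nonempty perm_r; split=> //.
- move=> h hr; have : uniq (pairs r).
    by rewrite (perm_uniq perm_r) map_inj_uniq // => x y [].
  case/splitPr: hr => r1 r2; rewrite pairs_cat cat_uniq /pairs /= cat_uniq.
  by case/and4P=> _ _ /map_uniq.
- move=> h x hr; rewrite (mem_group_pairs _ uniq_r hr) (perm_mem perm_r).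
  apply/mapP/andP => [[y y_xs [-> ->]]|[x_xs /eqP <-]]; last by exists x.
  by split=> //; apply/eqP.
Qed.

Lemma classes_of_subset val X r r' :
  classes_of val X r -> {subset r' <= r} -> uniq (keys r') ->
  classes_of val X r'.
Proof.
move=> [_ r_uniq r_nonempty r_mem] r'r uniq_r'; split=> // h.
- by move/r'r/r_uniq.
- by move/r'r/r_nonempty.
- by move=> x /r'r; apply: r_mem.
Qed.

Lemma classes_of_cons val X h r :
  classes_of val X (h :: r) -> classes_of val X r.
Proof.
move=> cls; apply: (classes_of_subset cls) => [h' h'r|];
  first exact: mem_behead.
by case/andP: (classes_keys_uniq cls).
Qed.

Lemma class_inj val X r h h' x : classes_of val X r -> h \in r -> h' \in r ->
  x \in h.2 -> x \in h'.2 -> h = h'.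
Proof.
move=> cls hr h'r; rewrite !(mem_class cls) //
  => /andP[_ /eqP vh] /andP[_ /eqP vh'].
by apply: (uniq_map_inj (classes_keys_uniq cls)); rewrite -?vh -?vh'.
Qed.

Lemma class_notin_states val X r1 h r2 x :
  classes_of val X (r1 ++ h :: r2) -> x \in h.2 -> x \notin states (r1 ++ r2).
Proof.
move=> cls xh; apply/mem_states => -[h' h'r xh'].
have r_subset h0 : h0 \in r1 ++ r2 -> h0 \in r1 ++ h :: r2.
  by rewrite !mem_cat inE => /orP[] ->; rewrite ?orbT.
have hr : h \in r1 ++ h :: r2 by rewrite mem_cat mem_head orbT.
have := classes_keys_uniq cls.
rewrite /keys (perm_uniq (perm_map _ (permEl (perm_catCA r1 [:: h] r2)))) /=.
by rewrite (class_inj cls hr (r_subset _ h'r) xh xh') map_f.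
Qed.

Lemma uniq_states val X r : classes_of val X r -> uniq (states r).
Proof.
elim: r => //= h r IH cls;
  rewrite /states /= cat_uniq (class_uniq cls) ?mem_head //.
rewrite [uniq _](IH (classes_of_cons cls)) andbT; apply/hasPn => x.
by apply: contraTN; apply: (class_notin_states (r1 := [::]) cls).
Qed.

Lemma classes_of_superset val (p : pred V) X X' r :
  (forall x, (x \in X') = (x \in X) && p (val x)) ->
  classes_of val X' r -> classes_of val X r.
Proof.
move=> X'E [r_uniq h_uniq h_n0 h_mem]; split=> // h x hr; rewrite h_mem // X'E.
case: (eqVneq (val x) h.1) => [->|_]; rewrite ?andbF // !andbT.
have /hasP[y] : has predT h.2 by rewrite has_predT lt0n h_n0.
by rewrite h_mem // X'E => /andP[/andP[_ py] /eqP <-] _; rewrite py andbT.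
Qed.

Lemma states_class val X r x : classes_of val X r -> x \in states r -> x \in X.
Proof.
by move=> cls /mem_states[h hr]; rewrite (mem_class cls) // => /andP[].
Qed.

(* The states of the one remaining class stay in the block that is split. *)
Record leaves_class val X r : Prop := LeavesClass {
  leaves_classes : classes_of val X r;
  leftover_exists : exists2 z, z \in X & z \notin states r;
  leftover_val : {in X &, forall x y,
    x \notin states r -> y \notin states r -> val x = val y}
}.

Lemma size_states_behead (p : bool) r :
  size (states (if p then behead r else r)) <= size (states r).
Proof.
by case: p => //; case: r => //= h r;
  rewrite -cat1s states_cat size_cat leq_addl.
Qed.

Lemma leaves_class_behead val X r x :
  classes_of val X r -> states r =i X -> x \in X ->
  leaves_class val X (behead r).
Proof.
case: r => [_ XE|h r cls XE _]; first by rewrite -XE.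
have h_r y : y \in h.2 -> y \notin states r
  by apply: (class_notin_states (r1 := [::]) cls).
have /hasP[z zh _] : has predT h.2.
  by rewrite has_predT lt0n (class_nonempty cls) ?mem_head.
split=> /=; first exact: classes_of_cons cls.
  by exists z; rewrite ?h_r // -XE mem_cat zh.
have in_h y : y \in X -> y \notin states r -> val y = h.1.
  rewrite -XE mem_cat => /orP[|->//].
  by rewrite (mem_class cls) ?mem_head // => /andP[_ /eqP].
by move=> y y' yX y'X yr y'r; rewrite !in_h.
Qed.

Lemma leaves_class_default val X r v z :
  classes_of val X r ->
  (forall x, (x \in states r) = (x \in X) && (val x != v)) ->
  z \in X -> val z = v -> leaves_class val X r.
Proof.
move=> cls rE zX zv; split=> //; first by exists z; rewrite // rE zv eqxx andbF.
by move=> x y xX yX; rewrite !rE xX yX !negbK => /eqP -> /eqP ->.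
Qed.

Lemma leaves_class_rest val v X (block xs : seq C) r :
  block =i X -> uniq block -> ~~ nilp block -> uniq xs ->
  (forall x, (x \in xs) = (x \in X) && (val x != v)) ->
  classes_of val [in xs] r -> states r =i xs ->
  leaves_class val X (if size xs == size block then behead r else r).
Proof.
move=> blockE uniq_block block_n0 uniq_xs xsE cls rE.
have {}cls : classes_of val X r.
  by apply: (classes_of_superset (p := [pred u | u != v])) cls.
have xs_block : {subset xs <= block} by move=> x; rewrite xsE blockE => /andP[].
case: eqP => size_xs.
  have /hasP[z z_block _] : has predT block by rewrite has_predT lt0n.
  apply: (leaves_class_behead (x := z) cls) => [x|]; last by rewrite -blockE.
  by rewrite rE (uniq_min_size uniq_xs xs_block _).2 ?size_xs // blockE.
have /hasP[z z_block z_xs] : has [predC xs] block.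
  apply: contra_notT size_xs; rewrite has_predC negbK => /allP block_xs.
  by apply/eqP; rewrite eqn_leq !uniq_leq_size.
apply: (leaves_class_default (v := v) (z := z) cls) => [x||].
- by rewrite rE xsE.
- by rewrite -blockE.
- by move: z_xs; rewrite /= xsE -blockE z_block negbK => /eqP.
Qed.

End Groups.

(** * Merge sort with grouping *)

(* When at most 2^e lists are merged, a value of multiplicity n is handled at
   most min(n, 2^i) times in the pass that merges at most 2^i of them. *)
Definition handled (e n : nat) : nat := \sum_(i < e) minn n (2 ^ i.+1).

Lemma handled_le e n : 0 < n -> handled e n <= n * (e - tl n) + 2 * n.
Proof.
move=> n_gt0; have [le_n _] := andP (trunc_log_bounds (isT : 1 < 2) n_gt0).
have handled_small d : d <= tl n -> handled d n <= 2 ^ d.+1.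
  elim: d => [|d IH] d_le; rewrite /handled ?big_ord0 // big_ord_recr /=.
  by rewrite [2 ^ d.+2]expnS mul2n -addnn leq_add ?geq_minr // IH // ltnW.
elim: e => [|e IH]; first by rewrite /handled big_ord0.
case: (leqP e.+1 (tl n)) => e_tl.
  apply: leq_trans (handled_small _ e_tl) (leq_trans _ (leq_addl _ _)).
  by rewrite expnS leq_mul2l /= (leq_trans _ le_n) // leq_exp2l.
rewrite /handled big_ord_recr subSn //= mulnS addnC -addnA leq_add //.
exact: geq_minl.
Qed.

Section MergeSort.
Context {F : set_functor} {A : Type} {flat : encoding F A}.
Context {I : refinement_interface flat} (M : implementation I) {C : finType}.

Local Notation value := {classic (F 'I_3)}.
Local Notation group := (value * seq C)%type.
Implicit Types (g : seq group) (gs : seq (seq group)).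

Definition ltv : rel value :=
  fun u v => if cmp3 M u v is Lt then true else false.

Lemma ltv_irr u : ltv u u = false.
Proof. by rewrite /ltv; have -> := (cmp3_eq M u u).2 erefl. Qed.

Lemma ltv_trans : transitive ltv.
Proof.
rewrite /ltv => v u w; case uv: cmp3 => // _; case vw: cmp3 => // _.
by rewrite (cmp3_trans uv vw).
Qed.

Definition sorted_groups g : bool :=
  pairwise ltv (keys g) && all (fun h : group => ~~ nilp h.2) g.

Lemma sorted_groups_cons v xs g : sorted_groups ((v, xs) :: g) =
  [&& all (ltv v) (keys g), ~~ nilp xs & sorted_groups g].
Proof. by rewrite /sorted_groups /= -andbA; do !bool_congr. Qed.

Lemma sorted_keys_uniq g : sorted_groups g -> uniq (keys g).
Proof.
case/andP=> + _; elim: (keys g) => //= u l IH /andP[ul /IH->]; rewrite andbT.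
by apply/negP => /(allP ul); rewrite ltv_irr.
Qed.

Variables (ks : seq value) (T : nat).
Hypothesis time_cmp3_le : {in ks &, forall u v, time_cmp3 M u v <= T}.

Definition merged g1 g2 (gk : seq group * nat) : Prop :=
  [/\ sorted_groups gk.1, keys gk.1 =i keys g1 ++ keys g2,
      perm_eq (pairs gk.1) (pairs g1 ++ pairs g2) &
      gk.2 <= 1 + (size g1 + size g2) * T.+1].

Lemma merged_sym g1 g2 gk : merged g1 g2 gk -> merged g2 g1 gk.
Proof.
case=> sorted_g keys_g pairs_g time_g; split=> //.
- by move=> v; rewrite keys_g !mem_cat orbC.
- by rewrite (perm_trans pairs_g) // perm_catC.
- by rewrite [size g2 + _]addnC.
Qed.

Lemma merged_lt u xs g1 v ys g2 r k t :
  cmp3 M u v = Lt -> t <= T ->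
  sorted_groups ((u, xs) :: g1) -> sorted_groups ((v, ys) :: g2) ->
  merged g1 ((v, ys) :: g2) (r, k) ->
  merged ((u, xs) :: g1) ((v, ys) :: g2) ((u, xs) :: r, 1 + t + k).
Proof.
move=> uv t_le; rewrite !sorted_groups_cons
  => /and3P[u_g1 xs_n0 _] /and3P[v_g2 _ _].
have {}uv : ltv u v by rewrite /ltv uv.
case=> /= sorted_r keys_r pairs_r time_r; split.
- rewrite sorted_groups_cons xs_n0 sorted_r (eq_all_r keys_r) all_cat u_g1 /=
    uv andbT.
  by apply: sub_all v_g2 => w; apply: ltv_trans.
- by move=> w; rewrite /= !inE keys_r.
- by rewrite /pairs /= -!catA perm_cat2l.
- by move: time_r t_le; clear; rewrite /= !(addSn, addnS, mulSn, mulnS); lia.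
Qed.

Lemma merged_eq u xs g1 ys g2 r k t :
  t <= T ->
  sorted_groups ((u, xs) :: g1) -> sorted_groups ((u, ys) :: g2) ->
  merged g1 g2 (r, k) ->
  merged ((u, xs) :: g1) ((u, ys) :: g2) ((u, xs ++ ys) :: r, 1 + t + k).
Proof.
move=> t_le; rewrite !sorted_groups_cons
  => /and3P[u_g1 xs_n0 _] /and3P[u_g2 _ _].
case=> /= sorted_r keys_r pairs_r time_r; split.
- rewrite sorted_groups_cons sorted_r (eq_all_r keys_r) all_cat u_g1 u_g2.
  by rewrite /nilp size_cat addn_eq0 negb_and xs_n0.
- by move=> w; rewrite /= !inE keys_r !mem_cat inE; case: eqP; rewrite ?orbT.
- rewrite /pairs /= map_cat -!catA perm_cat2l.
  by rewrite perm_sym perm_catCA perm_cat2l perm_sym; apply: pairs_r.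
- by move: time_r t_le; clear; rewrite /= !(addSn, addnS, mulSn, mulnS); lia.
Qed.

Lemma merge_groups_cons u xs g1 v ys g2 :
  merge_groups M ((u, xs) :: g1) ((v, ys) :: g2) =
  match cmp3 M u v with
  | Lt => let: (r, k) := merge_groups M g1 ((v, ys) :: g2) in
          ((u, xs) :: r, 1 + time_cmp3 M u v + k)
  | Eq => let: (r, k) := merge_groups M g1 g2 in
          ((u, xs ++ ys) :: r, 1 + time_cmp3 M u v + k)
  | Gt => let: (r, k) := merge_groups M ((u, xs) :: g1) g2 in
          ((v, ys) :: r, 1 + time_cmp3 M u v + k)
  end.
Proof. by []. Qed.

Lemma merge_groupsP g1 g2 :
  {subset keys g1 <= ks} -> {subset keys g2 <= ks} ->
  sorted_groups g1 -> sorted_groups g2 -> merged g1 g2 (merge_groups M g1 g2).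
Proof.
elim: g1 g2 => [|[u xs] g1 IH1] g2; first by case: g2 => [|[v ys] g2].
elim: g2 => [|[v ys] g2 IH2] ks1 ks2 s1 s2.
  by split; rewrite //= cats0.
have tail_subset w (g : seq group) zs : {subset keys ((w, zs) :: g) <= ks} ->
    w \in ks /\ {subset keys g <= ks}.
  by move=> sub; split=> [|k kg]; apply: sub; rewrite inE ?eqxx ?kg ?orbT.
have [[u_ks ks1'] [v_ks ks2']] :=
  (tail_subset _ _ _ ks1, tail_subset _ _ _ ks2).
have tail_sorted w (g : seq group) zs : sorted_groups ((w, zs) :: g) ->
  sorted_groups g.
  by rewrite sorted_groups_cons => /and3P[].
have time_uv := time_cmp3_le u_ks v_ks.
rewrite merge_groups_cons; case uv: cmp3.
- move/cmp3_eq: uv ks2 s2 => <- ks2 s2.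
  have := IH1 g2 ks1' ks2' (tail_sorted _ _ _ s1) (tail_sorted _ _ _ s2).
  by case: merge_groups => r k; apply: merged_eq => //; apply: time_cmp3_le.
- have := IH1 _ ks1' ks2 (tail_sorted _ _ _ s1) s2.
  by case: merge_groups => r k; apply: merged_lt.
- have := IH2 ks1 ks2' s1 (tail_sorted _ _ _ s2).
  have vu : cmp3 M v u = Lt by rewrite cmp3_sym uv.
  case: merge_groups => r k /merged_sym /(merged_lt vu time_uv s2 s1).
  exact: merged_sym.
Qed.

Lemma merge_passP gs :
  {subset keys (flatten gs) <= ks} -> all sorted_groups gs ->
  let: (gs', k) := (merge_pass M gs : seq (seq group) * nat) in
  [/\ all sorted_groups gs', keys (flatten gs') =i keys (flatten gs),
      perm_eq (pairs (flatten gs')) (pairs (flatten gs)),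
      size gs' = uphalf (size gs) &
      k <= 1 + size gs + size (flatten gs) * T.+1].
Proof.
move: {2}(size gs) (leqnn (size gs)) => n.
elim: n gs => [|n IH] [|g1 [|g2 gs]] //= le_n; try by move=> _ s1; split.
move=> keys_ks /and3P[s1 s2 s_gs].
have keys_cat (ga gb : seq group) : keys (ga ++ gb) = keys ga ++ keys gb
  by apply: map_cat.
have [ks1 ks2 ks_gs] : [/\ {subset keys g1 <= ks}, {subset keys g2 <= ks} &
    {subset keys (flatten gs) <= ks}].
  by split=> v v_in; apply: keys_ks; rewrite !keys_cat !mem_cat v_in ?orbT.
have := merge_groupsP ks1 ks2 s1 s2; case: merge_groups => g k.
case=> /= sorted_g keys_g pairs_g time_g.
have := IH gs (ltnW le_n) ks_gs s_gs; case: merge_pass => r k'.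
case=> sorted_r keys_r pairs_r size_r time_r; split.
- by rewrite /= sorted_g.
- by move=> v; rewrite /= !keys_cat !mem_cat keys_g keys_r mem_cat orbA.
- by rewrite /= !pairs_cat catA perm_cat.
- by rewrite /= size_r.
- by move: time_g time_r; clear; rewrite /= !size_cat !mulnDl; lia.
Qed.

(* Every list contains a value at most once, and every occurrence of the value
   accounts for at least one of the states with this value. *)
Lemma size_flatten_groups gs (r : seq group) n :
  all sorted_groups gs -> sorted_groups r ->
  perm_eq (pairs r) (pairs (flatten gs)) -> size gs <= n ->
  size (flatten gs) <= \sum_(h <- r) minn (size h.2) n.
Proof.
move=> sorted_gs sorted_r pairs_r gs_n;
  have uniq_r := sorted_keys_uniq sorted_r.
have gs_nonempty h : h \in flatten gs -> ~~ nilp h.2.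
  by case/flattenP=> g /(allP sorted_gs)/andP[_ /allP]; apply.
have keys_sub : {subset keys (flatten gs) <= keys r}.
  move=> v /mapP[h h_gs ->]; have := gs_nonempty h h_gs.
  case xs_eq: h.2 => [|x xs] // _; apply: (@pairs_keys _ _ _ _ x).
  rewrite (perm_mem pairs_r); apply/mem_pairs; exists h => //.
  by rewrite xs_eq mem_head.
rewrite -(size_map fst) -(sum_count_mem uniq_r keys_sub) big_map big_seq.
rewrite [X in _ <= X]big_seq; apply: leq_sum => h hr; rewrite leq_min;
  apply/andP; split.
  rewrite -(count_pairs_group uniq_r hr) (permP pairs_r) count_pairs count_map.
  rewrite -sum1_count big_seq_cond [X in _ <= X]big_seq_cond.
  by apply: leq_sum => h' /andP[/gs_nonempty + _]; rewrite lt0n.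
apply: leq_trans gs_n;
  rewrite /keys map_flatten count_flatten -!map_comp sumnE big_map.
rewrite -sum1_size big_seq [X in _ <= X]big_seq;
  apply: leq_sum => g /(allP sorted_gs) sg.
by rewrite /= count_uniq_mem ?sorted_keys_uniq // leq_b1.
Qed.

Lemma merge_passesP gs d e :
  {subset keys (flatten gs) <= ks} -> all sorted_groups gs ->
  size gs <= d -> size gs <= 2 ^ e ->
  let: (r, k) := (merge_passes M d gs : seq group * nat) in
  [/\ sorted_groups r, perm_eq (pairs r) (pairs (flatten gs)) &
      k <= 1 + 4 * 2 ^ e + (\sum_(h <- r) handled e (size h.2)) * T.+1].
Proof.
elim: d gs e => [|d IH] [|g1 [|g2 gs]] e //=; try by move=> *; split.
  by move=> _ /andP[s1 _] _ _; rewrite cats0; split.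
set gs0 := g1 :: g2 :: gs => keys_ks sorted_gs0 size_d size_e.
have := @merge_passP gs0 keys_ks sorted_gs0.
rewrite -[let: (g, _) := merge_groups M g1 g2 in _]/(merge_pass M gs0).
case: merge_pass => gs' k [sorted_gs' keys_gs' pairs_gs' size_gs' time_k].
have e_gt1 : 1 < 2 ^ e by apply: leq_trans size_e.
case: e => // e in size_e e_gt1 *.
have := IH gs' e _ sorted_gs'; case: merge_passes => r k' {}IH.
have {IH} [||| sorted_r pairs_r time_k'] := IH.
- by move=> v; rewrite keys_gs'; apply: keys_ks.
- by rewrite size_gs' /=; move: size_d; clear; rewrite uphalf_half; lia.
- by rewrite size_gs' uphalf_half; move: size_e; clear; rewrite expnS /=; lia.
have {}pairs_r := perm_trans pairs_r pairs_gs'; split=> //.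
have := size_flatten_groups (gs := gs0) sorted_gs0 sorted_r pairs_r size_e.
have -> : \sum_(h <- r) handled e.+1 (size h.2) =
    \sum_(h <- r) handled e (size h.2) +
    \sum_(h <- r) minn (size h.2) (2 ^ e.+1).
  by rewrite -big_split; apply: eq_bigr => h _; rewrite /handled big_ord_recr.
move/leq_mul/(_ (leqnn T.+1)); move: time_k time_k' size_e e_gt1.
rewrite -[(size gs).+2]/(size gs0) mulnDl expnS.
set merged_sum := \sum_(h <- r) minn _ _;
  set handled_sum := \sum_(h <- r) handled _ _.
by move: merged_sum handled_sum; clear; lia.
Qed.

End MergeSort.

Section GroupBy.
Context {F : set_functor} {A : Type} {flat : encoding F A}.
Context {I : refinement_interface flat} (M : implementation I) {C : finType}.

Local Notation value := {classic (F 'I_3)}.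
Local Notation group := (value * seq C)%type.

Lemma handled_le_entropy (r : seq group) : {in r, forall h, ~~ nilp h.2} ->
  \sum_(h <- r) handled (up_log 2 (size (states r))) (size h.2) <=
    entropy r + 3 * size (states r).
Proof.
move=> r_nonempty; set n := size (states r).
rewrite {2}/n size_states big_distrr -big_split /= big_seq [X in _ <= X]big_seq.
apply: leq_sum => h hr; have h_gt0 : 0 < size h.2 by rewrite lt0n r_nonempty.
apply: leq_trans (handled_le _ h_gt0) _; rewrite -/n.
have : up_log 2 n <= (tl n).+1.
  by apply: up_log_min => //; apply/ltnW/trunc_log_ltn.
move=> up_n; rewrite [3 * _]mulSn addnA leq_add2r addnC -mulnS leq_mul2l.
by apply/orP; right; move: up_n; move: (up_log 2 n) (tl n) (tl (size h.2));
  clear; lia.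
Qed.

Lemma exp_up_log_le n : 2 ^ up_log 2 n <= 2 * n + 1.
Proof.
case: (ltnP 1 n) => [n_gt1|n_le1]; last first.
  have /eqP -> : up_log 2 n == 0 by rewrite up_log_eq0 n_le1 orbT.
  by rewrite addn1.
have := up_log_gtn (isT : 1 < 2) n_gt1.
have : 0 < up_log 2 n by rewrite up_log_gt0.
by case: up_log => // e _; rewrite expnS /=; lia.
Qed.

Lemma group_byP T (val : C -> value) (xs : seq C) St :
  0 < T -> uniq xs -> {in xs &, forall x y, time_cmp3 M (val x) (val y) <= T} ->
  wp (group_by M [seq (val x, x) | x <- xs]) (fun (r : seq group) s k =>
    [/\ s = St, classes_of val [in xs] r, perm_eq (states r) xs &
        k <= 20 * T * (1 + size xs + entropy r)]) St.
Proof.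
move=> T_gt0 uniq_xs time_le; rewrite /group_by -map_comp.
set gs : seq (seq group) := map _ xs.
have pairs_gs : pairs (flatten gs) = [seq (val x, x) | x <- xs].
  by rewrite /gs; elim: (xs) => //= x l; rewrite /pairs /= => ->.
have sorted_gs : all (sorted_groups M) gs
  by rewrite /gs; elim: (xs) => //= x l ->.
pose ks := [seq val x | x <- xs].
have time_ks : {in ks &, forall u v, time_cmp3 M u v <= T}.
  by move=> _ _ /mapP[x xs_x ->] /mapP[y xs_y ->]; apply: time_le.
have keys_gs : {subset keys (flatten gs) <= ks}.
  by rewrite /gs /ks; elim: (xs) => //= x l IH v;
    rewrite !inE => /orP[->|/IH ->] //; rewrite orbT.
have size_gs : size gs = size xs by rewrite size_map.
have := merge_passesP time_ks keys_gs sorted_gs (leqnn _) (@up_logP 2 _ isT).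
rewrite pairs_gs size_gs size_map; case: merge_passes => r0 k;
  move: (r0 : seq group) => r [sorted_r pairs_r time_k].
have perm_r : perm_eq (states r) xs.
  rewrite -map_snd_pairs (perm_trans (perm_map _ pairs_r)) // -map_comp.
  by rewrite (eq_map (g := id)) // map_id.
have r_nonempty : {in r, forall h, ~~ nilp h.2}
  by case/andP: sorted_r => _ /allP.
apply: wp_call; split=> //.
  exact: classes_of_pairs (sorted_keys_uniq sorted_r) _ pairs_r.
have := handled_le_entropy r_nonempty; rewrite (perm_size perm_r).
have := exp_up_log_le (size xs); move: time_k.
move: (size xs) (entropy r) (2 ^ _) (\sum_(h <- r) _) T_gt0; clear.
move=> n ent e handled_r T_gt0 time_k e_le /leq_mul/(_ (leqnn T.+1)) handled_le.
have : n <= T * n by rewrite leq_pmull.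
have : ent <= T * ent by rewrite leq_pmull.
by move: time_k handled_le; rewrite !mulnDl !mulnDr !muln1 !mulnS; lia.
Qed.

End GroupBy.

(** * Behavioural equivalence *)

Lemma factor_through (X Y Z : Type) (f : X -> Y) (g : X -> Z) (z0 : Z) :
  (forall x x', f x = f x' -> g x = g x') ->
  exists h : Y -> Z, g = fun x => h (f x).
Proof.
move=> fg.
exists (fun y => if pselect (exists x, f x = y) is left ex
                 then g (projT1 (cid ex)) else z0).
apply/funext => x; case: pselect => [ex|[]]; last by exists x.
by case: cid => x' /= /fg.
Qed.

Section Behaviour.
Context {F : set_functor}.

Lemma fmap_eq_coarser (X Y Z : Type) (f : X -> Y) (g : X -> Z) (z0 : Z)
    (t u : F X) :
  (forall x x', f x = f x' -> g x = g x') ->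
  fmap f t = fmap f u -> fmap g t = fmap g u.
Proof.
by move=> /(factor_through z0)[h ->] tu; rewrite !(fmap_comp h f) tu.
Qed.

Lemma behaviourally_equivalent_fmap (C Z : Type) (c : C -> F C) (g : C -> Z)
    (z0 : Z) x y :
  (forall x y, behaviourally_equivalent c x y -> g x = g y) ->
  behaviourally_equivalent c x y -> fmap g (c x) = fmap g (c y).
Proof.
move=> cg [D [d [h [hm hxy]]]].
have hg x' y' : h x' = h y' -> g x' = g y'.
  by move=> hx'y'; apply: cg; exists D, d, h.
by apply: (fmap_eq_coarser z0 hg); rewrite !hm hxy.
Qed.

Lemma stable_kernel_behaviourally_equivalent (C D : Type) (c : C -> F C)
    (f : C -> D) :
  (forall x y, f x = f y -> fmap f (c x) = fmap f (c y)) ->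
  forall x y, f x = f y -> behaviourally_equivalent c x y.
Proof.
move=> f_stable x y fxy.
have [d dE] := factor_through (fmap f (c x)) f_stable.
by exists D, d, f; split=> // z; have /(congr1 (@^~ z)) := dE.
Qed.

End Behaviour.

(** * Splitting a class *)

Section SplitClass.
Context {T : Type} {K : eqType}.
Implicit Types (S : {pred T}) (f : T -> K) (q : K).

Definition class_at f y : set T := [set z | f z = f y]%classic.

Definition split_class S f q' y : K := if y \in S then q' else f y.

Lemma class_at_split_in S f q' y : (forall z, f z != q') -> y \in S ->
  class_at (split_class S f q') y = [set` S]%classic.
Proof.
move=> fresh yS; apply/seteqP; split=> z; rewrite /class_at /split_class /= yS.
  by case: ifP => // _ fz; have := fresh z; rewrite fz eqxx.
by move=> ->.
Qed.

Lemma class_at_split_rest S f q q' y : (forall z, f z != q') ->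
  (forall z, z \in S -> f z = q) -> y \notin S -> f y = q ->
  class_at (split_class S f q') y = ([set z | f z = q] `\` [set` S])%classic.
Proof.
move=> fresh S_q /negPf yS fy; apply/seteqP; split=> z;
  rewrite /class_at /split_class /= yS fy.
  by case: ifP => // _ qq'; have := fresh y; rewrite fy qq' eqxx.
by case=> fz /negP/negPf ->.
Qed.

Lemma class_at_split_other S f q q' y : (forall z, f z != q') ->
  (forall z, z \in S -> f z = q) -> f y != q ->
  class_at (split_class S f q') y = class_at f y.
Proof.
move=> fresh S_q fy_q.
have yS : (y \in S) = false by apply: contraNF fy_q => /S_q ->.
apply/seteqP; split=> z; rewrite /class_at /split_class /= yS;
  case: ifP => // /S_q fz.
  by move=> q'fy; have := fresh y; rewrite -q'fy eqxx.
by rewrite fz => qfy; rewrite qfy eqxx in fy_q.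
Qed.

End SplitClass.

(* The split of the class q into S and its complement is the kernel of a map
   into K + bool, for which zippability reduces equality to the values of [F f]
   and [F chi_S^B]. *)
Lemma zippable_split (F : set_functor) (T : Type) (K : eqType) (S : {pred T})
    (f : T -> K) (q q' : K) (t u : F T) :
  zippable F -> (forall y, y \in S -> f y = q) ->
  fmap f t = fmap f u ->
  fmap (chi [set` S] [set y | f y = q]) t =
    fmap (chi [set` S] [set y | f y = q]) u ->
  fmap (split_class S f q') t = fmap (split_class S f q') u.
Proof.
move=> zipF S_q f_tu chi_tu.
have notin_S z : f z != q -> (z \in S) = false by apply: contraNF => /S_q ->.
pose h y : K + bool := if f y == q then inr (y \in S) else inl (f y).
apply: (fmap_eq_coarser (f := h) q') => [y y'|].
  rewrite /h /split_class; case: (eqVneq (f y) q) => [fy|fy];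
    case: (eqVneq (f y') q) => [fy'|fy'] // -[]; first by rewrite fy fy' => ->.
  by rewrite !notin_S.
apply: zipF; congr pair; rewrite -!fmap_comp.
  apply: (fmap_eq_coarser (inr tt) _ f_tu) => y y' fyy'.
  by rewrite /h fyy'; case: ifP.
apply: (fmap_eq_coarser (inl tt) _ chi_tu) => y y'.
have chiE z : chi [set` S] [set y | f y = q]%classic z =
    if z \in S then two3 else if f z == q then one3 else zero3.
  rewrite /chi /= asboolb (_ : `[< f z = q >] = (f z == q)) //.
  exact/asboolP/eqP.
have h_in z : z \in S -> h z = inr true.
  by rewrite /h => zS; rewrite (S_q _ zS) eqxx zS.
rewrite !chiE; case: (boolP (y \in S)) => [/h_in hy|yS];
  case: (boolP (y' \in S)) => [/h_in hy'|y'S];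
  rewrite ?hy ?hy' //; try by case: ifP.
by rewrite /h (negPf yS) (negPf y'S); do 2!case: ifP.
Qed.

(** * Weights and edges *)

Section Weights.
Context {F : set_functor} {A : Type} {flat : encoding F A} {W : Type}.
Context {init : F unit -> bag A -> W} {update : bag A -> W -> W * F 'I_3 * W}.
Context {w : forall X : Type, set X -> F X -> W}.
Hypothesis weightP : weight_family flat init update w.

Lemma labels_into_set0 X (b : bag (A * X)) : labels_into b set0 = bag_of [::].
Proof.
rewrite /labels_into; congr bag_of.
by rewrite (eq_filter (a2 := pred0)) ?filter_pred0 // => e; apply: asboolF.
Qed.

Lemma update_nil X (t : F X) (B : set X) :
  update (bag_of [::]) (w B t) = (w set0 t, fmap (chi set0 B) t, w B t).
Proof.
by have [_ /(_ set0 B (@sub0set _ B))] := weightP t;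
  rewrite labels_into_set0 setD0.
Qed.

Lemma update_no_labels X (t : F X) (S B : set X) :
  (S `<=` B)%classic -> labels_into (flat t) S = bag_of [::] ->
  fmap (chi S B) t = fmap (chi set0 B) t /\ w (B `\` S)%classic t = w B t.
Proof.
move=> SB no_labels; have [_ /(_ S B SB)] := weightP t.
by rewrite no_labels update_nil => -[_ <- <-].
Qed.

End Weights.

Lemma bag_of_perm (T : Type) (s1 s2 : seq {classic T}) :
  perm_eq s1 s2 -> bag_of s1 = bag_of s2.
Proof. by move=> /eq_seq_msetP. Qed.

Lemma bag_size_of (T : Type) (s : seq T) : bag_size (bag_of s) = size s.
Proof. exact: perm_size (@perm_eq_seq_mset {classic T} s). Qed.

Lemma filter_allpairs_fst (K : eqType) (T : Type) (s : seq K)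
    (t : K -> seq T) x :
  uniq s ->
  [seq p.2 | p <- [seq (y, e) | y <- s, e <- t y] & p.1 == x] =
    if x \in s then t x else [::].
Proof.
have fiber y : [seq p.2 | p <- [seq (y, e) | e <- t y] & p.1 == x] =
    if y == x then t y else [::].
  rewrite filter_map -map_comp; case: (eqVneq y x) => [->|/negPf yx].
    by rewrite (eq_filter (a2 := predT)) ?filter_predT ?map_id // => e;
      rewrite /= eqxx.
  by rewrite (eq_filter (a2 := pred0)) ?filter_pred0.
elim: s => //= y s IH /andP[ys /IH {}IH].
rewrite filter_cat map_cat fiber IH inE [x == y]eq_sym.
by case: eqVneq ys => [-> /negPf ->|_ _]; rewrite ?cats0.
Qed.

Section Edges.
Context {F : set_functor} {A : Type} {flat : encoding F A} {C : finType}.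
Variable c : C -> F C.

Local Notation edgeT := {classic (edge A C)}.
Local Notation E := (edges (flat := flat) c : seq edgeT).

Lemma edge_ids : [seq edge_id e | e <- E] = iota 0 (size E).
Proof.
rewrite /edges -map_comp size_map size_zip size_iota minnn.
set es := flatten _.
by rewrite -[RHS](@unzip1_zip _ _ (iota 0 (size es)) es) ?size_iota //.
Qed.

Lemma edge_id_inj : {in E &, injective (@edge_id A C)}.
Proof.
apply: (@uniq_map_inj edgeT _ (@edge_id A C)).
by rewrite [map _ _]edge_ids iota_uniq.
Qed.

Lemma mem_edge_ids (e : edgeT) (es : seq edgeT) : e \in E -> {subset es <= E} ->
  (edge_id e \in [seq edge_id e | e <- es]) = (e \in es).
Proof.
move=> eE esE; apply/(@mapP edgeT)/idP => [[e' e'es ee']|e_es];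
  last by exists e.
by rewrite (edge_id_inj eE (esE _ e'es) ee').
Qed.

Lemma size_edges : size E = num_edges flat c.
Proof.
rewrite /edges size_map size_zip size_iota minnn size_allpairs_dep.
by rewrite sumnE big_map big_enum.
Qed.

Lemma edges_from x :
  [seq (edge_lab e, edge_tgt e) | e <- E & edge_src e == x] =
    elems (flat (c x)).
Proof.
have := filter_allpairs_fst (fun x => elems (flat (c x))) x (enum_uniq C).
rewrite mem_enum inE /edges => <-; set es := flatten _.
transitivity [seq p.2 | p <- unzip2 (zip (iota 0 (size es)) es) & p.1 == x];
  last by rewrite unzip2_zip ?size_iota.
rewrite /unzip2; elim: (zip _ _) => //= -[i [y [a z]]] l IH /=.
by case: eqP => _ /=; rewrite IH.
Qed.

Definition out_edges (x : C) : seq edgeT := [seq e <- rev E | edge_src e == x].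

Definition in_edges (y : C) : seq edgeT := [seq e <- rev E | edge_tgt e == y].

Definition edges_into (ys : seq C) : seq edgeT :=
  [seq e <- E | edge_tgt e \in ys].

Definition edges_from_into (x : C) (ys : seq C) : seq edgeT :=
  [seq e <- edges_into ys | edge_src e == x].

Lemma mem_edges_into ys e :
  (e \in edges_into ys) = (edge_tgt e \in ys) && (e \in E).
Proof. by rewrite mem_filter. Qed.

Lemma mem_edges_from_into x ys e :
  (e \in edges_from_into x ys) =
    [&& edge_src e == x, edge_tgt e \in ys & e \in E].
Proof. by rewrite mem_filter mem_edges_into. Qed.

Lemma perm_edges_into (ys : seq C) : uniq ys ->
  perm_eq (flatten [seq in_edges y | y <- ys]) (edges_into ys).
Proof.
move=> uniq_ys; apply: (perm_trans (perm_flatten_fibers _ _ uniq_ys)).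
by rewrite filter_rev perm_rev.
Qed.

Lemma sum_size_out_edges : \sum_x size (out_edges x) = size E.
Proof. by rewrite (sum_size_fibers (fun e : edgeT => edge_src e)) size_rev. Qed.

Lemma sum_size_in_edges : \sum_y size (in_edges y) = size E.
Proof. by rewrite (sum_size_fibers (fun e : edgeT => edge_tgt e)) size_rev. Qed.

Lemma label_bag_perm (es es' : seq edgeT) :
  perm_eq es es' -> label_bag es = label_bag es'.
Proof.
by move=> /(perm_map (fun e : edgeT => edge_lab e : {classic A}))/bag_of_perm.
Qed.

Lemma bag_size_label_bag (es : seq edgeT) : bag_size (label_bag es) = size es.
Proof. by rewrite /label_bag bag_size_of size_map. Qed.

Lemma label_bag_out_edges x : label_bag (out_edges x) = labels (flat (c x)).
Proof.
rewrite (label_bag_perm (es' := [seq e <- E | edge_src e == x])).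
  by rewrite /labels -edges_from -map_comp.
by rewrite /out_edges filter_rev perm_rev.
Qed.

Lemma label_bag_from_into x ys :
  label_bag (edges_from_into x ys) = labels_into (flat (c x)) [set` ys].
Proof.
rewrite /label_bag /labels_into -edges_from filter_map -map_comp.
rewrite /edges_from_into /edges_into -!filter_predI; congr (bag_of (map _ _)).
by apply: eq_filter => e /=; rewrite asboolb andbC.
Qed.

End Edges.

(** * The partitions P and Q *)

Section BlockTables.
Context {T : eqType}.
Implicit Types (D : pred T) (n b : nat) (blk : T -> nat) (mem : nat -> seq T).
Implicit Types (xs ys : seq T).

Record block_table D n blk mem : Prop := BlockTable {
  block_uniq : forall b, b < n -> uniq (mem b);
  mem_block : forall b x, b < n -> (x \in mem b) = D x && (blk x == b);
  blk_lt : forall x, D x -> blk x < n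
}.

Lemma eq_block_table D D' n blk mem :
  D =1 D' -> block_table D n blk mem -> block_table D' n blk mem.
Proof. by move=> /funext ->. Qed.

Lemma block_table_add D n blk mem xs :
  block_table D n blk mem -> uniq xs -> {in xs, forall x, ~~ D x} ->
  block_table (fun x => D x || (x \in xs)) n.+1
    (fun x => if x \in xs then n else blk x) (set_at mem n xs).
Proof.
case=> mem_uniq memE blk_n uniq_xs xs_new; split=> [b|b x|x].
- by rewrite /set_at ltnS leq_eqVlt; case: eqP => //= _; apply: mem_uniq.
- rewrite /set_at ltnS leq_eqVlt; case: (eqVneq b n) => [-> _|b_n /= b_lt].
    case: (boolP (x \in xs)) => _; first by rewrite orbT eqxx.
    by rewrite orbF; case Dx: (D x) => //=; rewrite ltn_eqF ?blk_n.
  rewrite memE //; case: (boolP (x \in xs)) => [/xs_new/negPf ->|_] /=.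
    by rewrite eq_sym (negPf b_n).
  by rewrite orbF.
- case: ifP => _; first by rewrite ltnS.
  by rewrite orbF ltnS => /blk_n/ltnW.
Qed.

Lemma block_table_remove D n blk mem b xs ys :
  block_table D n blk mem -> b < n -> perm_eq (xs ++ ys) (mem b) ->
  block_table (fun x => D x && (x \notin xs)) n blk (set_at mem b ys).
Proof.
case=> mem_uniq memE blk_n b_lt perm_b.
have := mem_uniq b b_lt;
  rewrite -(perm_uniq perm_b) cat_uniq => /and3P[_ xs_ys uniq_ys].
have mem_b x : (x \in xs) || (x \in ys) = D x && (blk x == b).
  by rewrite -memE // -(perm_mem perm_b) mem_cat.
split=> [b'|b' x|x].
- by rewrite /set_at; case: eqP => // _; apply: mem_uniq.
- rewrite /set_at; case: (eqVneq b' b) => [-> _|b'b /memE ->].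
    rewrite andbAC -mem_b; case: (boolP (x \in ys)) => [x_ys|_].
      by rewrite orbT (hasPn xs_ys).
    by rewrite orbF andbN.
  case: (boolP (x \in xs)) => [x_xs|_]; rewrite ?andbT // andbF.
  have := mem_b x; rewrite x_xs => /esym/andP[_ /eqP ->].
  by rewrite eq_sym (negPf b'b) andbF.
- by case/andP=> /blk_n.
Qed.

Lemma block_table_insert D n blk mem q x :
  block_table D n blk mem -> q < n -> ~~ D x ->
  block_table (fun y => (y == x) || D y) n (set_at blk x q)
    (set_at mem q (x :: mem q)).
Proof.
case=> mem_uniq memE blk_n q_lt x_new; split=> [b b_lt|b y b_lt|y].
- rewrite /set_at; case: eqP => _; last exact: mem_uniq.
  by rewrite /= memE // (negPf x_new) mem_uniq.
- rewrite /set_at; case: (eqVneq b q) => [->|b_q].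
    by rewrite inE memE //; case: (eqVneq y x) => //= _; rewrite eqxx.
  rewrite memE //; case: (eqVneq y x) => //= ->.
  by rewrite (negPf x_new) /= eq_sym (negPf b_q).
- by rewrite /set_at; case: eqP => // _ /blk_n.
Qed.

End BlockTables.

Section Partitions.
Context {F : set_functor} {A W : Type} {C : finType}.
Implicit Types (s : memory F A W C) (D : pred C) (xs : seq C).

Record partitions D s : Prop := Partitions {
  p_table : block_table D (pnum s) (pblk s) (pmem s);
  pmem_nonempty : forall b, b < pnum s -> ~~ nilp (pmem s b);
  q_table : block_table (fun b => b < pnum s) (qnum s) (qblk s) (qmem s);
  work_uniq : uniq (work s);
  mem_work : forall q, (q \in work s) = (q < qnum s) && (1 < size (qmem s q))
}.

Lemma eq_partitions D D' s : D =1 D' -> partitions D s -> partitions D' s.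
Proof. by move=> /funext ->. Qed.

Definition partition_fields s :=
  (pnum s, pblk s, pmem s, qnum s, qblk s, qmem s, work s).

Definition other_fields s :=
  (pred_edges s, to_sub s, last_w s, cnum s, cell s, mark s, touched s).

Lemma partitions_fields D s s' :
  partition_fields s' = partition_fields s -> partitions D s -> partitions D s'.
Proof.
case=> e1 e2 e3 e4 e5 e6 e7 [pt pne qt wu mw].
by split; rewrite ?e1 ?e2 ?e3 ?e4 ?e5 ?e6 ?e7.
Qed.

Lemma mem_pmem s b x : partitions predT s -> b < pnum s ->
  (x \in pmem s b) = (pblk s x == b).
Proof. by move=> Ps b_lt; rewrite (mem_block (p_table Ps)). Qed.

Lemma pblk_lt s x : partitions predT s -> pblk s x < pnum s.
Proof. by move=> Ps; apply: (blk_lt (p_table Ps)). Qed.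

Definition qclass s (x : C) : nat := qblk s (pblk s x).

Lemma qclass_lt s x : partitions predT s -> qclass s x < qnum s.
Proof. by move=> Ps; apply/(blk_lt (q_table Ps))/pblk_lt. Qed.

Lemma qclass_pblk s x y : partitions predT s -> nilp (work s) ->
  qclass s x = qclass s y -> pblk s x = pblk s y.
Proof.
move=> Ps no_work qxy; have q_lt := qclass_lt x Ps.
have := mem_work Ps (qclass s x); rewrite (nilP no_work) q_lt.
have mem_q z : qclass s z = qclass s x -> pblk s z \in qmem s (qclass s x).
  by move=> qzx; rewrite (mem_block (q_table Ps)) // pblk_lt //= -qzx.
have := mem_q x erefl; have := mem_q y (esym qxy).
by case: (qmem s _) => [|b [|b2 l]] //; rewrite !inE => /eqP -> /eqP ->.
Qed.

(* The operations on the memory are spelled out with the constructor, rather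
   than with the setters, so that all projections compute. *)
Definition add_block (q : nat) xs s : memory F A W C :=
  Memory (pnum s).+1 (fun x => if x \in xs then pnum s else pblk s x)
    (set_at (pmem s) (pnum s) xs) (qnum s) (set_at (qblk s) (pnum s) q)
    (set_at (qmem s) q (pnum s :: qmem s q))
    (if size (qmem s q) == 1 then q :: work s else work s)
    (pred_edges s) (to_sub s) (last_w s) (cnum s) (cell s) (mark s) (touched s).

Lemma partitions_add_block D s q xs :
  partitions D s -> uniq xs -> ~~ nilp xs -> {in xs, forall x, ~~ D x} ->
  q < qnum s -> partitions (fun x => D x || (x \in xs)) (add_block q xs s).
Proof.
case=> pt pne qt wu mw uniq_xs xs_n0 xs_new q_lt; split=> /=.
- exact: block_table_add.
- by move=> b; rewrite /set_at ltnS leq_eqVlt; case: eqP => //= _; apply: pne.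
- apply: eq_block_table (block_table_insert qt q_lt _); last by rewrite ltnn.
  by move=> b /=; rewrite ltnS [in RHS]leq_eqVlt.
- by case: ifP => [/eqP size_q|_] //=; rewrite mw wu size_q andbF.
- move=> q'; rewrite /set_at; case: (eqVneq q' q) => [->|q'q]; last first.
    by case: ifP => _; rewrite ?inE ?(negPf q'q) mw.
  case: ifP => [/eqP size_q|]; first by rewrite mem_head q_lt /= size_q.
  by rewrite mw q_lt /=; case: (size _) => [|[]].
Qed.

Definition detach (b : nat) xs s : memory F A W C :=
  Memory (pnum s) (pblk s) (set_at (pmem s) b [seq y <- pmem s b | y \notin xs])
    (qnum s) (qblk s) (qmem s) (work s)
    (pred_edges s) (to_sub s) (last_w s) (cnum s) (cell s) (mark s) (touched s).

Lemma partitions_detach s b xs z :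
  partitions predT s -> b < pnum s -> uniq xs ->
  {subset xs <= pmem s b} -> z \in pmem s b -> z \notin xs ->
  partitions (fun x => x \notin xs) (detach b xs s).
Proof.
case=> pt pne qt wu mw b_lt uniq_xs xs_b zb z_xs; split=> //=.
  apply: (@block_table_remove _ predT _ _ _ _ xs) => //.
  rewrite perm_sym -(perm_filterC [in xs]); apply: perm_cat => //.
  rewrite perm_sym; apply: uniq_perm; rewrite ?filter_uniq ?(block_uniq pt) //.
  by move=> x; rewrite mem_filter; case: (boolP (x \in xs)) => // /xs_b ->.
move=> b' b'_lt; rewrite /set_at; case: eqP => _; last exact: pne.
by rewrite /nilp size_filter -lt0n -has_count; apply/hasP; exists z.
Qed.

Definition split_q (q b : nat) (rest : seq nat) s : memory F A W C :=
  Memory (pnum s) (pblk s) (pmem s) (qnum s).+1 (set_at (qblk s) b (qnum s))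
    (set_at (set_at (qmem s) q rest) (qnum s) [:: b])
    (if size rest == 1 then behead (work s) else work s)
    (pred_edges s) (to_sub s) (last_w s) (cnum s) (cell s) (mark s) (touched s).

Lemma partitions_split_q s q b rest wk :
  partitions predT s -> work s = q :: wk -> perm_eq (b :: rest) (qmem s q) ->
  ~~ nilp rest -> partitions predT (split_q q b rest s).
Proof.
case=> pt pne qt wu mw wk_eq perm_q rest_n0.
have [q_lt _] : q < qnum s /\ 1 < size (qmem s q).
  by apply/andP; rewrite -mw wk_eq mem_head.
have b_lt : b < pnum s.
  have : b \in qmem s q by rewrite -(perm_mem perm_q) mem_head.
  by rewrite (mem_block qt) // => /andP[].
have size_rest : 0 < size rest by rewrite lt0n.
split=> //=.
- have removed := block_table_remove (xs := [:: b]) qt q_lt perm_q.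
  have := block_table_add (xs := [:: b]) removed isT.
  rewrite (_ : (fun x => _) = set_at (qblk s) b (qnum s)); last first.
    by apply/funext => b'; rewrite /set_at inE.
  move=> added; apply: eq_block_table (added _) => [b'|b']; rewrite !inE.
    by case: eqP => [->|_] /=; rewrite ?b_lt ?orbT // andbT orbF.
  by move/eqP ->; rewrite eqxx andbF.
- by case: ifP => _ //; move: wu; rewrite wk_eq => /andP[].
- have [q_wk uniq_wk] : q \notin wk /\ uniq wk.
    by apply/andP; move: wu; rewrite wk_eq.
  move=> q1; have := mw q1; rewrite wk_eq /= => mem_q1.
  rewrite ltnS leq_eqVlt /set_at.
  case: (eqVneq q1 (qnum s)) mem_q1 => [->|q1_n] mem_q1 /=.
    rewrite ltnn in mem_q1; apply: contraFF mem_q1.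
    by case: ifP => // _; apply: (mem_behead (s := q :: wk)).
  case: (eqVneq q1 q) mem_q1 => [->|q1_q] mem_q1; last first.
    by rewrite -mem_q1; case: ifP => _; rewrite // inE (negPf q1_q).
  case: ifP => [/eqP ->|/eqP]; first by rewrite (negPf q_wk) andbF.
  by rewrite mem_head q_lt /=; case: (size rest) size_rest => [|[|]].
Qed.

Lemma qclass_split_q s q b rest : partitions predT s -> b < pnum s ->
  qclass (split_q q b rest s) = split_class [in pmem s b] (qclass s) (qnum s).
Proof.
move=> Ps b_lt; apply/funext => x; rewrite /qclass /split_class /= /set_at.
by rewrite (mem_pmem x Ps).
Qed.

Record refines (V : Type) (val : C -> V) (D : {pred C}) s s' : Prop := Refines {
  refines_partitions : partitions predT s';
  refines_qclass : qclass s' = qclass s;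
  refines_pblk : forall x, x \notin D -> pblk s' x = pblk s x;
  refines_kernel : forall x y, pblk s' x = pblk s' y <->
    pblk s x = pblk s y /\ ((x \in D) || (y \in D) -> val x = val y)
}.

Section Refines.
Context {V : Type} {val : C -> V}.
Implicit Types (X : {pred C}).

Lemma refines_refl s : partitions predT s -> refines val pred0 s s.
Proof. by move=> Ps; split=> // x y; split=> [|[]]. Qed.

Lemma eq_refines X X' s s' :
  X =i X' -> refines val X s s' -> refines val X' s s'.
Proof.
move=> XX' [Ps qE pE kerE]; split=> // [x|x y]; first by rewrite -XX' => /pE.
by rewrite -!XX'.
Qed.

Lemma refines_trans X X' s s' s'' :
  refines val X s s' -> refines val X' s' s'' ->
  refines val [predU X & X'] s s''.
Proof.
move=> [_ qE pE kerE] [Ps' qE' pE' kerE']; split=> //.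
- by rewrite qE'.
- by move=> x; rewrite !inE negb_or => /andP[/pE <- /pE'].
- move=> x y; rewrite kerE' kerE !inE; split=> [[[pxy vX] vX']|[pxy v]].
    by split=> //; rewrite orbACA => /orP[].
  by split; [split=> //|] => xyX; apply: v; rewrite orbACA xyX ?orbT.
Qed.

Lemma refines_widen X X' s s' : {subset X <= X'} ->
  (forall x y, pblk s x = pblk s y -> x \notin X -> y \notin X ->
     (x \in X') || (y \in X') -> val x = val y) ->
  refines val X s s' -> refines val X' s s'.
Proof.
move=> XX' val_const [Ps qE pE kerE]; split=> // [x|x y].
  by move=> xX'; apply: pE; apply: contra xX'; apply: XX'.
rewrite kerE; split=> -[pxy v]; split=> // xyX.
  case: (boolP ((x \in X) || (y \in X))) => [/v //|].
  by rewrite negb_or => /andP[xX yX]; apply: val_const.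
by apply: v; case/orP: xyX => /XX' ->; rewrite ?orbT.
Qed.

Lemma refines_fields X s1 s s' : partition_fields s1 = partition_fields s ->
  refines val X s1 s' -> refines val X s s'.
Proof.
case=> _ pE _ _ qE _ _ [Ps qclassE pblkE kerE].
by split=> //; rewrite -?pE // qclassE /qclass pE qE.
Qed.

End Refines.

Lemma refines_split_block (V : eqType) (val : C -> V) v s b xs z :
  partitions predT s -> uniq xs -> ~~ nilp xs ->
  (forall x, (x \in xs) = (pblk s x == b) && (val x == v)) ->
  pblk s z = b -> z \notin xs ->
  refines val [in xs] s (add_block (qblk s b) xs (detach b xs s)).
Proof.
move=> Ps uniq_xs xs_n0 xsE zb z_xs.
have b_lt : b < pnum s by rewrite -zb pblk_lt.
have detached : partitions (fun x => x \notin xs) (detach b xs s).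
  apply: (partitions_detach (z := z)) => // [x|]; last by rewrite mem_pmem ?zb.
  by rewrite mem_pmem // xsE => /andP[].
split=> /=.
- have added := partitions_add_block detached uniq_xs xs_n0.
  apply: eq_partitions (added _ _ _) => [x|x|] /=.
  + by rewrite orNb.
  + by rewrite negbK.
  + exact: (blk_lt (q_table Ps)).
- apply/funext => x; rewrite /qclass /= /set_at;
    case: (boolP (x \in xs)) => x_xs.
    by move: x_xs; rewrite eqxx xsE => /andP[/eqP ->].
  by rewrite ltn_eqF // pblk_lt.
- by move=> x /negPf ->.
- have p_neq x : (pnum s == pblk s x) = false by rewrite gtn_eqF // pblk_lt.
  have separated x y : x \in xs -> y \notin xs ->
      ~ (pblk s x = pblk s y /\ val x = val y).
    by rewrite !xsE => x_xs /negP y_xs [pxy vxy]; apply: y_xs;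
      rewrite -pxy -vxy.
  move=> x y; case: (boolP (x \in xs)) => x_xs;
    case: (boolP (y \in xs)) => y_xs /=.
  + split=> // _; move: x_xs y_xs; rewrite !xsE.
    by move=> /andP[/eqP -> /eqP ->] /andP[/eqP -> /eqP ->].
  + split=> [/eqP|[pxy vxy]]; first by rewrite p_neq.
    by case: (separated x y) => //; split=> //; apply: vxy.
  + split=> [/esym/eqP|[pxy vxy]]; first by rewrite p_neq.
    by case: (separated y x) => //; split=> //; apply/esym/vxy.
  + by split=> [|[]].
Qed.

Lemma leaves_class_pmem (V : eqType) (val : C -> V) v s b xs r :
  partitions predT s -> b < pnum s -> uniq xs ->
  (forall x, (x \in xs) = (pblk s x == b) && (val x != v)) ->
  classes_of val [in xs] r -> perm_eq (states r) xs ->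
  leaves_class val [pred x | pblk s x == b]
    (if size xs == size (pmem s b) then behead r else r).
Proof.
move=> Ps b_lt uniq_xs xsE cls /perm_mem r_xs.
apply: (leaves_class_rest (v := v)) cls r_xs => // [x||].
- by rewrite mem_pmem.
- exact: (block_uniq (p_table Ps)).
- exact: (pmem_nonempty Ps).
Qed.

End Partitions.

Section BlockOperations.
Context {F : set_functor} {A : Type} {flat : encoding F A}.
Context {I : refinement_interface flat} {C : finType}.
Local Notation store := (memory F A (weight I) C).
Implicit Types (s : store) (xs : seq C).

Lemma new_blockP s q xs :
  wp (new_block q xs) (fun _ s' k =>
    s' = add_block q xs s /\ k <= 8 + 2 * size xs) s.
Proof.
case: s => pn pb pm qn qb qm wk pe ts lw cn cl mk td;
  rewrite /new_block; wp_run.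
pose g (done : seq C) : store :=
  Memory pn.+1 (fun x => if x \in done then pn else pb x)
    (set_at pm pn xs) qn qb qm wk pe ts lw cn cl mk td.
have put_g done x : put_pblk x pn (g done) = (tt, g (rcons done x), 1).
  congr (_, Memory _ _ _ _ _ _ _ _ _ _ _ _ _ _, _); apply/funext => y /=.
  by rewrite /set_at mem_rcons inE; case: eqP.
apply: (wp_of_eq (for_each_iter xs put_g)); wp_run => /=.
by apply: wp_when => [size1|/negPf sizeN1]; wp_run; split;
  rewrite /add_block /= ?size1 ?sizeN1 //; lia.
Qed.

Lemma split_offP s b xs : uniq (pmem s b) ->
  wp (split_off b xs) (fun _ s' k =>
    s' = add_block (qblk s b) xs (detach b xs s) /\ k <= 9 + 5 * size xs) s.
Proof.
move=> uniq_b; rewrite /split_off; wp_run.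
pose remove x : prog store unit :=
  let* ys := read (fun s => pmem s b) in put_pmem b (rem x ys).
have removeE done x : remove x (detach b done s) =
  (tt, detach b (rcons done x) s, 2).
  congr (_, Memory _ _ _ _ _ _ _ _ _ _ _ _ _ _, _).
  apply/funext => b' /=; rewrite /set_at eqxx; case: eqP => // _.
  rewrite rem_filter ?filter_uniq // -filter_predI; apply: eq_filter => y /=.
  by rewrite mem_rcons inE negb_or.
have detach0 : detach b [::] s = s.
  case: (s) => *; congr Memory; apply/funext => b';
    rewrite /set_at filter_predT.
  by case: eqP => [->|].
have remove_run := for_each_iter xs (g := fun done => detach b done s) removeE.
rewrite detach0 in remove_run; apply: (wp_of_eq remove_run); wp_run.
by apply: wp_conseq (new_blockP _ _ _) => _ s' k [-> k_le]; split=> //; lia.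
Qed.

Lemma split_groupsP (V : eqType) (val : C -> V) s b z (r : seq (V * seq C)) :
  partitions predT s -> classes_of val [pred x | pblk s x == b] r ->
  pblk s z = b -> z \notin states r ->
  wp (for_each r (fun h => split_off b h.2)) (fun _ s' k =>
    [/\ refines val [in states r] s s', other_fields s' = other_fields s &
        k <= 15 * size (states r)]) s.
Proof.
move=> Ps cls zb z_r.
apply: (wp_for_each (Inv := fun done s' k =>
  [/\ refines val [in states done] s s', other_fields s' = other_fields s &
      k <= 15 * size (states done)])).
  by split=> //; apply: eq_refines (refines_refl Ps).
move=> done h todo s' k r_eq [ref others_eq k_le].
have hr : h \in r by rewrite r_eq mem_cat mem_head orbT.
have h_done x : x \in h.2 -> x \notin states done.
  rewrite r_eq in cls; move/(class_notin_states cls).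
  by rewrite states_cat mem_cat negb_or => /andP[].
have [z_done z_h] : z \notin states done /\ z \notin h.2.
  move: z_r; rewrite r_eq -cat_rcons states_cat states_rcons !mem_cat !negb_or.
  by case/andP=> /andP[].
have zb' : pblk s' z = b by rewrite (refines_pblk ref).
have Ps' := refines_partitions ref.
have hE x : (x \in h.2) = (pblk s' x == b) && (val x == h.1).
  apply/idP/idP => [xh|/andP[/eqP xb vx]].
    by rewrite (refines_pblk ref) ?h_done // -(mem_class cls).
  rewrite (mem_class cls) // vx inE andbT -zb; apply/eqP.
  by have [] := (refines_kernel ref x z).1 (etrans xb (esym zb')).
have uniq_b : uniq (pmem s' b)
  by rewrite (block_uniq (p_table Ps')) // -zb' pblk_lt.
have ref_h := refines_split_block Ps' (class_uniq cls hr)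
  (class_nonempty cls hr) hE zb' z_h.
apply: wp_conseq (split_offP _ uniq_b) => _ s'' k' [-> k'_le];
  split.
- apply: eq_refines (refines_trans ref ref_h) => x.
  by rewrite !inE states_rcons mem_cat.
- exact: others_eq.
- have h_gt0 : 0 < size h.2 by rewrite lt0n (class_nonempty cls).
  rewrite states_rcons size_cat.
  by move: (size (states done)) (size h.2) k_le k'_le h_gt0; clear; lia.
Qed.

Lemma split_leaves_classP (V : eqType) (val : C -> V) s b
    (r : seq (V * seq C)) :
  partitions predT s -> leaves_class val [pred x | pblk s x == b] r ->
  wp (for_each r (fun h => split_off b h.2)) (fun _ s' k =>
    [/\ refines val [pred x | pblk s x == b] s s',
        other_fields s' = other_fields s &
        k <= 15 * size (states r)]) s.
Proof.
move=> Ps [cls [z /eqP zb z_r] val_out].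
apply: wp_conseq (split_groupsP Ps cls zb z_r) => _ s' k [ref others k_le];
  split=> //.
apply: refines_widen ref => [x|x y pxy x_r y_r xy_b].
  exact: (states_class cls).
by apply: val_out; move: xy_b; rewrite !inE pxy orbb.
Qed.

Lemma new_blocksP (V : eqType) (val : C -> V) (X : {pred C}) s q
    (r : seq (V * seq C)) :
  partitions pred0 s -> q < qnum s -> classes_of val X r ->
  wp (for_each r (fun h => new_block q h.2)) (fun _ s' k =>
    [/\ partitions [in states r] s',
        {in states r &, forall x y, pblk s' x = pblk s' y <-> val x = val y},
        (qnum s', other_fields s') = (qnum s, other_fields s) &
        k <= 11 * size (states r)]) s.
Proof.
move=> Ps q_lt cls; apply: (wp_for_each (Inv := fun done s' k =>
  [/\ partitions [in states done] s',
      {in states done &, forall x y, pblk s' x = pblk s' y <-> val x = val y},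
      (qnum s', other_fields s') = (qnum s, other_fields s) &
      k <= 11 * size (states done)])) => //.
move=> done h todo s' k r_eq [Ps' kerE fields_eq k_le].
have hr : h \in r by rewrite r_eq mem_cat mem_head orbT.
have h_done : {in h.2, forall x, x \notin states done}.
  rewrite r_eq in cls => x /(class_notin_states cls).
  by rewrite states_cat mem_cat negb_or => /andP[].
have q_lt' : q < qnum s' by case: fields_eq => ->.
have added := partitions_add_block Ps' (class_uniq cls hr)
  (class_nonempty cls hr) h_done q_lt'.
apply: wp_conseq (new_blockP s' q h.2) => _ s'' k' [-> k'_le]; split.
- by apply: eq_partitions added => x; rewrite states_rcons mem_cat.
- move=> x y; rewrite states_rcons !mem_cat /= => x_r y_r.
  have p_neq z : z \in states done -> pblk s' z <> pnum s'.
    by move=> /(blk_lt (p_table Ps')) + E; rewrite E ltnn.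
  have val_h z : z \in h.2 -> val z = h.1
    by rewrite (mem_class cls) // => /andP[_ /eqP].
  have val_neq z z' : z \in states done -> z' \in h.2 -> val z <> val z'.
    move=> z_done z'h vzz'; suff /h_done/negP : z \in h.2 by [].
    rewrite (mem_class cls) // vzz' val_h // eqxx andbT.
    apply: (states_class cls).
    by rewrite r_eq states_cat mem_cat z_done.
  case: (boolP (x \in h.2)) => xh; case: (boolP (y \in h.2)) => yh.
  + by rewrite !val_h.
  + rewrite (negPf yh) orbF in y_r.
    by split=> [/esym/(p_neq _ y_r)|/esym/(val_neq _ _ y_r xh)].
  + rewrite (negPf xh) orbF in x_r.
    by split=> [/(p_neq _ x_r)|/(val_neq _ _ x_r yh)].
  + by rewrite (negPf xh) (negPf yh) !orbF in x_r y_r *; apply: kerE.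
- exact: fields_eq.
- have h_gt0 : 0 < size h.2 by rewrite lt0n (class_nonempty cls).
  rewrite states_rcons size_cat.
  by move: (size (states done)) (size h.2) k_le k'_le h_gt0; clear; lia.
Qed.

End BlockOperations.

(** * Potentials *)

Definition class_size (C : finType) (f : C -> nat) (x : C) : nat :=
  #|[pred y | f y == f x]|.

Definition potential (C : finType) (g f : C -> nat) : nat :=
  \sum_x g x * tl (class_size f x).

Section Potentials.
Context {C : finType}.
Implicit Types (f g : C -> nat).

Lemma potential_le g f : potential g f <= (\sum_x g x) * tl #|C|.
Proof.
rewrite big_distrl /=; apply: leq_sum => x _.
by rewrite leq_mul // leq_trunc_log // max_card.
Qed.

(* The cost of grouping is paid for by the states moving to smaller classes. *)
Lemma entropy_potential (V : eqType) (val : C -> V) f f' b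
    (r : seq (V * seq C)) :
  (forall x y, f' x = f' y -> f x = f y /\ (f x = b -> val x = val y)) ->
  classes_of val [pred x | f x == b] r ->
  potential (fun=> 1) f' + entropy r <= potential (fun=> 1) f.
Proof.
move=> f'f cls; pose gain x := tl (class_size f x) - tl (class_size f' x).
have class_size_le x : class_size f' x <= class_size f x.
  by apply/subset_leq_card/fintype.subsetP => y; rewrite !inE => /eqP /f'f[->].
have -> : potential (fun=> 1) f = potential (fun=> 1) f' + \sum_x gain x.
  rewrite /potential -big_split /=; apply: eq_bigr => x _.
  by rewrite !mul1n subnKC // leq_trunc_log.
rewrite leq_add2l (bigID [in states r]) /=; apply: leq_trans (leq_addr _ _).
rewrite -big_uniq ?(uniq_states cls) // /entropy [X in _ <= X]big_flatten
  big_map /=.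
rewrite big_seq [X in _ <= X]big_seq; apply: leq_sum => h hr.
rewrite -sum1_size big_distrl /= big_seq [X in _ <= X]big_seq.
apply: leq_sum => x xh; rewrite mul1n sum1_size.
have [/eqP fx vx] := andP (etrans (esym (mem_class cls x hr)) xh).
apply: leq_sub; apply: leq_trunc_log.
  rewrite -(card_uniqP (uniq_states cls));
    apply/subset_leq_card/fintype.subsetP => y.
  by move/(states_class cls); rewrite !inE fx.
apply: leq_trans (card_size h.2); apply/subset_leq_card/fintype.subsetP => y.
rewrite inE => /eqP/f'f[fyx vyx]; rewrite (mem_class cls) // inE fyx fx eqxx.
by rewrite vyx ?fyx.
Qed.

Lemma potential_split g f (ys : seq C) q' :
  uniq ys -> ~~ nilp ys -> (forall y, f y != q') ->
  (forall y, y \in ys -> 2 * size ys <= class_size f y) ->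
  potential g (split_class [in ys] f q') + \sum_(y <- ys) g y <= potential g f.
Proof.
move=> uniq_ys ys_n0 fresh ys_small.
rewrite big_uniq //= [X in _ + X]big_mkcond /potential -big_split /=.
have class_split y z :
    split_class [in ys] f q' z == split_class [in ys] f q' y ->
    if y \in ys then z \in ys else f z == f y.
  rewrite /split_class; case: (y \in ys); case: (z \in ys) => // /eqP E.
    by have := fresh z; rewrite E eqxx.
  by have := fresh y; rewrite E eqxx.
apply: leq_sum => y _; case: ifP => y_ys; last first.
  rewrite addn0 leq_mul // leq_trunc_log //;
    apply/subset_leq_card/fintype.subsetP => z.
  by move/class_split; rewrite y_ys.
rewrite addnC -mulnS leq_mul //
  (leq_trans _ (leq_trunc_log 2 (ys_small _ y_ys))) //.
have ys_gt0 : 0 < size ys by rewrite lt0n.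
rewrite mul2n trunc_log2_double // ltnS leq_trunc_log //.
apply: leq_trans (card_size ys); apply/subset_leq_card/fintype.subsetP => z.
by move/class_split; rewrite y_ys.
Qed.

End Potentials.

(** * The memory cells *)

Section Cells.
Context {F : set_functor} {A : Type} {flat : encoding F A}.
Context {I : refinement_interface flat} {C : finType} (c : C -> F C).
Local Notation store := (memory F A (weight I) C).
Local Notation edgeT := {classic (edge A C)}.
Local Notation E := (edges (flat := flat) c : seq edgeT).
Implicit Types (s : store) (es D : seq edgeT).

Record cells_agree (K : Type) D (key : edgeT -> K)
    (wt : edgeT -> weight I) s : Prop := CellsAgree {
  last_w_lt : forall e, e \in D -> last_w s (edge_id e) < cnum s;
  cell_last_w : forall e, e \in D ->
    cell s (last_w s (edge_id e)) = Some (wt e);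
  last_w_eq : forall e e', e \in D -> e' \in D ->
    last_w s (edge_id e) = last_w s (edge_id e') <-> key e = key e'
}.

Definition cell_fields s := (last_w s, cnum s, cell s).

Lemma cells_agree_fields K D (key : edgeT -> K) wt s s' :
  cell_fields s' = cell_fields s -> cells_agree D key wt s ->
  cells_agree D key wt s'.
Proof. by case=> el en ec [lw_lt cl_w lw_eq]; split; rewrite ?el ?en ?ec. Qed.

Lemma eq_cells_agree K D (key key' : edgeT -> K) wt wt' s :
  {in D, key =1 key'} -> {in D, wt =1 wt'} ->
  cells_agree D key wt s -> cells_agree D key' wt' s.
Proof.
move=> keyE wtE [lw_lt cl_w lw_eq]; split=> // [e eD|e e' eD e'D].
  by rewrite cl_w // wtE.
by rewrite lw_eq // !keyE.
Qed.

Definition overwrite i v s : store :=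
  Memory (pnum s) (pblk s) (pmem s) (qnum s) (qblk s) (qmem s) (work s)
    (pred_edges s) (to_sub s) (last_w s) (cnum s) (set_at (cell s) i (Some v))
    (mark s) (touched s).

Lemma cells_agree_overwrite (K : eqType) D (key : edgeT -> K) wt s e0 v :
  e0 \in D -> cells_agree D key wt s ->
  cells_agree D key (fun e => if key e == key e0 then v else wt e)
    (overwrite (last_w s (edge_id e0)) v s).
Proof.
move=> e0D [lw_lt cl_w lw_eq]; split=> //= e eD; rewrite /set_at.
case: eqP => [/lw_eq -> //|]; first by rewrite eqxx.
by rewrite lw_eq // => /eqP/negPf ->; apply: cl_w.
Qed.

Definition redirect es v s : store :=
  Memory (pnum s) (pblk s) (pmem s) (qnum s) (qblk s) (qmem s) (work s)
    (pred_edges s) (to_sub s)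
    (fun i => if i \in [seq edge_id e | e <- es] then cnum s else last_w s i)
    (cnum s).+1 (set_at (cell s) (cnum s) (Some v)) (mark s) (touched s).

Lemma cells_agree_redirect (K : eqType) D D' es (key key' : edgeT -> K)
    wt wt' k v s :
  {subset D' <= E} -> {subset es <= E} ->
  (forall e, e \in D' -> e \in es -> key' e = k /\ wt' e = v) ->
  (forall e, e \in D' -> e \notin es ->
    [/\ e \in D, key' e = key e, key e != k & wt' e = wt e]) ->
  cells_agree D key wt s -> cells_agree D' key' wt' (redirect es v s).
Proof.
move=> D'E esE in_es out_es [lw_lt cl_w lw_eq].
have ids e : e \in D' -> (edge_id e \in [seq edge_id e | e <- es]) = (e \in es).
  by move=> eD'; rewrite (mem_edge_ids (D'E _ eD') esE).
split=> /= [e eD'|e eD'|e e' eD' e'D']; rewrite !ids // /set_at.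
- by case: (boolP (e \in es)) => // /(out_es _ eD')[/lw_lt/ltnW].
- case: (boolP (e \in es)) => [/(in_es _ eD')[_ ->]|/(out_es _ eD')[eD _ _ ->]].
    by rewrite eqxx.
  by rewrite ltn_eqF ?lw_lt ?cl_w.
- case: (boolP (e \in es))
    => [/(in_es _ eD')[-> _]|/(out_es _ eD')[eD -> /eqP ke _]];
    case: (boolP (e' \in es))
      => [/(in_es _ e'D')[-> _]|/(out_es _ e'D')[e'D -> /eqP ke' _]] //.
  + by split=> [cnE|/esym//]; have := lw_lt _ e'D; rewrite -cnE ltnn.
  + by split=> [cnE|//]; have := lw_lt _ eD; rewrite cnE ltnn.
  + exact: lw_eq.
Qed.

Definition clear_to_sub x s : store :=
  Memory (pnum s) (pblk s) (pmem s) (qnum s) (qblk s) (qmem s) (work s)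
    (pred_edges s) (set_at (to_sub s) x [::]) (last_w s) (cnum s) (cell s)
    (mark s) (touched s).

Lemma for_each_put_last_w (es : seq (edge A C)) i s :
  for_each es (fun e => put_last_w e i) s =
  (tt,
   set_last_w
     (fun j => if j \in [seq edge_id e | e <- es] then i else last_w s j) s,
   2 * size es).
Proof.
pose g (done : seq (edge A C)) := set_last_w
  (fun j => if j \in [seq edge_id e | e <- done] then i else last_w s j) s.
have put_g done e : put_last_w e i (g done) = (tt, g (rcons done e), 1).
  rewrite /g; case: s g => * /=;
    congr (_, Memory _ _ _ _ _ _ _ _ _ _ _ _ _ _, _).
  by apply/funext => j; rewrite /set_at map_rcons mem_rcons inE; case: eqP.
have g_nil : g [::] = s by rewrite /g; case: s {g put_g}.
by have := for_each_iter es (f := fun e => put_last_w e i) put_g; rewrite g_nil.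
Qed.

End Cells.

Section CellPrograms.
Context {F : set_functor} {A : Type} {flat : encoding F A}.
Context {I : refinement_interface flat} (M : implementation I) {C : finType}.
Local Notation value := {classic (F 'I_3)}.
Local Notation store := (memory F A (weight I) C).

Lemma init_weights_run (c : C -> F C) (s : store) x :
  let es := to_sub s x in let l := label_bag es in
  wp (init_weights M c x) (fun _ s' k =>
    s' = clear_to_sub x (redirect es (init I (type_of c x) l) s) /\
    k = 5 + 3 * size es + time_init M (type_of c x) l) s.
Proof.
rewrite /init_weights /new_cell /=; case: s => *; wp_run => /=.
apply: (wp_of_eq (for_each_put_last_w _ _ _)); wp_run; split=> //=; lia.
Qed.

Lemma update_state_run (s : store) x i (v0 v : value) wB wS wR :
  let es := to_sub s x in let l := label_bag es in
  cell s i = Some wB -> update l wB = (wS, v, wR) ->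
  wp (update_state M v0 (x, i)) (fun o s' k =>
    [/\ s' = clear_to_sub x (redirect es wS (overwrite i wR s)),
        o = (if v == v0 then None else Some (v, x)) &
        k = 7 + 3 * size es + time_update M l wB + time_cmp3 M v v0]) s.
Proof.
case: s => pn pb pm qn qb qm wk pe ts lw cn cl mk td /= cell_i updE.
rewrite /update_state /new_cell; wp_run; rewrite /= cell_i; wp_run;
  rewrite updE /=; wp_run.
apply: (wp_of_eq (for_each_put_last_w _ _ _)); wp_run; split=> //=; last by lia.
have cmpE := cmp3_eq M v v0; case: eqP => [/cmpE -> //|v_v0].
by case cmp_v: cmp3 => //; case: v_v0; apply/cmpE.
Qed.

End CellPrograms.

Section TimeBound.
Context {F : set_functor} {A : Type} {flat : encoding F A}.
Context {I : refinement_interface flat} {C : finType}.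

Record time_bound (M : implementation I) (c : C -> F C)
    (w : forall X : Type, set X -> F X -> weight I) (T : nat) :
    Prop := TimeBound {
  time_bound_gt0 : 0 < T;
  time_bound_init : forall x, time_init M (type_of c x) (labels (flat (c x)))
    <= T * maxn 1 (bag_size (labels (flat (c x))));
  time_bound_update : forall x (S B : set C), (S `<=` B)%classic ->
    time_update M (labels_into (flat (c x)) S) (w C B (c x))
    <= T * maxn 1 (bag_size (labels_into (flat (c x)) S));
  time_bound_cmp3 : forall u v, observations c u -> observations c v ->
    time_cmp3 M u v <= T
}.

End TimeBound.

Section Consistency.
Context {F : set_functor} {A : Type} {flat : encoding F A}.
Context {I : refinement_interface flat} {C : finType} (c : C -> F C).
Variable w : forall X : Type, set X -> F X -> weight I.
Local Notation store := (memory F A (weight I) C).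
Local Notation edgeT := {classic (edge A C)}.
Local Notation E := (edges (flat := flat) c : seq edgeT).

(* [cls x] is the partition to which the cells of the edges from x refer:
   while P is refined, only some of the states have been updated. *)
Definition edge_key (cls : C -> C -> nat) (e : edgeT) : C * nat :=
  (edge_src e, cls (edge_src e) (edge_tgt e)).

Definition edge_weight (cls : C -> C -> nat) (e : edgeT) : weight I :=
  w (class_at (cls (edge_src e)) (edge_tgt e)) (c (edge_src e)).

Definition cells_refer_to (cls : C -> C -> nat) (s : store) : Prop :=
  cells_agree E (edge_key cls) (edge_weight cls) s.

(* [f] is the quotient map of the partition Q to which the weights refer; in the
   middle of a refinement step it lags behind [qclass s]. *)
Record consistent (f : C -> nat) (s : store) : Prop := Consistent {
  consistent_partitions : partitions predT s;
  consistent_pred_edges : pred_edges s = in_edges (flat := flat) c;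
  consistent_to_sub : to_sub s = (fun=> [::]);
  consistent_mark : mark s = (fun=> [::]);
  consistent_touched : touched s = [::];
  consistent_cells : cells_refer_to (fun=> f) s;
  consistent_stable : forall x y, pblk s x = pblk s y ->
    fmap f (c x) = fmap f (c y)
}.

End Consistency.

(** * Refining P by one block *)

Section RefineBy.
Context {F : set_functor} {A : Type} {flat : encoding F A}.
Context {I : refinement_interface flat} (M : implementation I) {C : finType}.
Variable c : C -> F C.
Variable w : forall X : Type, set X -> F X -> weight I.
Hypothesis weightP : weight_family flat (init I) (@update _ _ _ I) w.
Variable T : nat.
Hypothesis timeP : time_bound M c w T.

Local Notation value := {classic (F 'I_3)}.
Local Notation store := (memory F A (weight I) C).
Local Notation edgeT := {classic (edge A C)}.
Local Notation E := (edges (flat := flat) c : seq edgeT).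
Local Notation in_edges := (in_edges (flat := flat) c).
Local Notation edges_into := (edges_into (flat := flat) c).
Local Notation edges_from_into := (edges_from_into (flat := flat) c).

Variables (ys : seq C) (f : C -> nat) (q q' : nat).
Hypothesis ys_uniq : uniq ys.
Hypothesis ys_q : forall y, y \in ys -> f y = q.
Hypothesis q'_fresh : forall y, f y != q'.

Variable s0 : store.
Hypothesis s0_consistent : consistent c w f s0.

Local Notation f' := (split_class [in ys] f q').
Local Notation S := [set` ys]%classic.
Local Notation B := [set y | f y = q]%classic.

Definition split_value (x : C) : value := fmap (chi S B) (c x).

Definition unmarked_value (x : C) : value := fmap (chi set0 B) (c x).

Lemma ys_sub_q : (S `<=` B)%classic.
Proof. by move=> y; apply: ys_q. Qed.

Lemma split_value_observed x : observations c (split_value x).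
Proof. by exists x, S, B; split=> //; apply: ys_sub_q. Qed.

Lemma unmarked_value_observed x : observations c (unmarked_value x).
Proof. by exists x, set0, B; split=> //; apply: sub0set. Qed.

Lemma unmarked_value_pblk x y :
  pblk s0 x = pblk s0 y -> unmarked_value x = unmarked_value y.
Proof.
move=> /(consistent_stable s0_consistent);
  apply: (fmap_eq_coarser zero3) => z z' zz'.
by rewrite /chi /= zz'.
Qed.

Definition sources (es : seq edgeT) : seq C := [seq edge_src e | e <- es].

Lemma mem_sources_rev es x : (x \in sources (rev es)) = (x \in sources es).
Proof. by rewrite /sources map_rev mem_rev. Qed.

Definition visit_frame (s : store) :=
  (partition_fields s, pred_edges s, cell_fields s).

(* The lists grow at the front, and [undup] keeps the last occurrence. *)
Record visited (vis : seq edgeT) (s : store) : Prop := Visited {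
  visited_frame : visit_frame s = visit_frame s0;
  visited_to_sub : forall x,
    to_sub s x = [seq e <- rev vis | edge_src (e : edgeT) == x];
  visited_mark : forall b, [seq xi.1 | xi <- mark s b] =
    [seq x <- undup (sources (rev vis)) | pblk s0 x == b];
  visited_mark_cell : forall b xi, xi \in mark s b ->
    exists2 e, e \in vis & xi = (edge_src e, last_w s0 (edge_id e));
  visited_touched : [seq bv.1 | bv <- touched s] =
    undup [seq pblk s0 x | x <- sources (rev vis)];
  visited_touched_value : forall bv, bv \in (touched s : seq (nat * value)) ->
    exists x, bv = (pblk s0 x, unmarked_value x)
}.

Lemma visited_nil : visited [::] s0.
Proof.
have [_ _ ts0 mk0 td0 _ _] := s0_consistent.
by split; rewrite ?ts0 ?mk0 ?td0.
Qed.

Lemma nilp_to_sub vis s x : visited vis s ->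
  nilp (to_sub s x) = (x \notin sources vis).
Proof.
move=> vs; rewrite (visited_to_sub vs) /nilp size_filter -leqn0 leqNgt
  -has_count.
congr negb; rewrite has_rev.
by apply/(@hasP edgeT)/(@mapP edgeT) => [[e e_vis /eqP <-]|[e e_vis ->]];
  exists e.
Qed.

Lemma mem_mark vis s b x : visited vis s ->
  (x \in [seq xi.1 | xi <- mark s b]) = (pblk s0 x == b) && (x \in sources vis).
Proof.
by move=> vs; rewrite (visited_mark vs) mem_filter mem_undup mem_sources_rev.
Qed.

Lemma mem_touched vis s b : visited vis s ->
  (b \in [seq bv.1 | bv <- touched s]) = ~~ nilp (mark s b).
Proof.
move=> vs; rewrite (visited_touched vs) mem_undup;
  apply/mapP/idP => [[x + ->]|].
  rewrite mem_sources_rev => x_vis; apply/nilP => mk_nil.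
  by have := mem_mark (pblk s0 x) x vs; rewrite mk_nil x_vis eqxx.
case mk: (mark s b) => [|[x i] l] // _; have := mem_mark b x vs.
by rewrite mk mem_head => /esym/andP[/eqP <- x_vis]; exists x;
  rewrite ?mem_sources_rev.
Qed.

Definition record_visit (e : edgeT) (s : store) : store :=
  let x := edge_src e in let b := pblk s x in
  Memory (pnum s) (pblk s) (pmem s) (qnum s) (qblk s) (qmem s) (work s)
    (pred_edges s) (set_at (to_sub s) x (e :: to_sub s x))
    (last_w s) (cnum s) (cell s)
    (if nilp (to_sub s x)
     then set_at (mark s) b ((x, last_w s (edge_id e)) :: mark s b) else mark s)
    (if nilp (mark s b) then (b, unmarked_value x) :: touched s else touched s).

Lemma visited_rcons vis s e : visited vis s ->
  visited (rcons vis e) (record_visit e s).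
Proof.
move=> vs; have := visited_frame vs.
case=> _ pblkE _ _ _ _ _ _ last_wE _ _.
have mk_nil b : nilp (mark s b) = (b \notin [seq bv.1 | bv <- touched s]).
  by rewrite (mem_touched _ vs) negbK.
have {}mk_nil b : nilp (mark s b) =
  (b \notin [seq pblk s0 x | x <- sources (rev vis)]).
  by rewrite mk_nil (visited_touched vs) mem_undup.
split; first exact: visited_frame vs.
- move=> x; rewrite /= rev_rcons /= -(visited_to_sub vs)
    /set_at [edge_src e == x]eq_sym.
  by case: eqP => // ->.
- move=> b; rewrite rev_rcons /= mem_sources_rev (nilp_to_sub _ vs) pblkE.
  case: (boolP (edge_src e \in _)) => x_vis /=; first exact: visited_mark.
  rewrite /set_at [pblk s0 _ == b]eq_sym; case: eqP => [->|_] /=;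
  by rewrite ?(visited_mark vs).
- move=> b xi; have old : xi \in mark s b ->
      exists2 e0, e0 \in rcons vis e & xi =
        (edge_src e0, last_w s0 (edge_id e0)).
    case/(visited_mark_cell vs) => e' e'_vis ->; exists e' => //.
    by rewrite mem_rcons inE e'_vis orbT.
  rewrite /= last_wE; case: ifP => // _; rewrite /set_at; case: eqP => // b_eq.
  rewrite inE => /predU1P[->|xi_b]; last by apply: old; rewrite b_eq.
  by exists e => //; rewrite mem_rcons mem_head.
- rewrite rev_rcons /= pblkE mk_nil; case: ifP => [/negPf|/negbFE] -> /=;
  by rewrite (visited_touched vs).
- move=> bv; rewrite /= pblkE; case: ifP => _;
    last exact: (visited_touched_value vs).
  rewrite inE => /predU1P[->|]; last exact: (visited_touched_value vs).
  by exists (edge_src e).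
Qed.

Lemma visit_edgeP vis s e : visited vis s -> e \in E -> edge_tgt e \in ys ->
  wp (visit_edge M e)
     (fun _ s' k => s' = record_visit e s /\ 1 + k <= 11 * T) s.
Proof.
move=> vs eE e_ys.
set x := edge_src e; have T_gt0 := time_bound_gt0 timeP.
have cell_x : cell s (last_w s (edge_id e)) = Some (w B (c x)).
  case: (visited_frame vs) => _ _ _ _ _ _ _ _ -> _ ->.
  rewrite (cell_last_w (consistent_cells s0_consistent) eE) /edge_weight.
  by congr (Some (w _ _)); rewrite /class_at (ys_q e_ys).
have time_upd :
    time_update M (label_bag ([::] : seq (edge A C))) (w B (c x)) <= T.
  have := time_bound_update timeP x (@sub0set _ B).
  by rewrite labels_into_set0 bag_size_of maxn0 muln1.
have mk_to_sub : nilp (mark s (pblk s x)) -> nilp (to_sub s x).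
  rewrite (nilp_to_sub _ vs) => /nilP mk; apply/negP => x_vis.
  have := mem_mark (pblk s x) x vs; rewrite mk x_vis.
  by case: (visited_frame vs) => _ -> _ _ _ _ _ _ _ _ _; rewrite eqxx.
move: cell_x mk_to_sub; rewrite /record_visit /visit_edge -/x.
case: s {vs} => pn pb pm qn qb qm wk pe ts lw cn cl mk td /= cell_x mk_to_sub;
  wp_run.
have upd := update_nil weightP (c x) B.
apply: wp_when => mk_x; wp_run => /=.
  rewrite cell_x; wp_run; rewrite /= mk_to_sub //; wp_run; split=> /=.
    by rewrite mk_x /label_bag upd.
  by move: (time_update _ _ _) time_upd T_gt0; clear; lia.
by apply: wp_when => [|/negPf] ts_x; wp_run; rewrite /= ?ts_x (negPf mk_x);
  split=> //; lia.
Qed.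

Lemma visit_statesP :
  wp (for_each ys (fun y =>
        let* es := read (fun s => pred_edges s y) in
        for_each es (visit_edge M)))
     (fun _ s' k =>
        visited (flatten [seq in_edges y | y <- ys]) s' /\
        k <= 2 * size ys +
             11 * (T * size (flatten [seq in_edges y | y <- ys]))) s0.
Proof.
apply: (wp_for_each (Inv := fun done s' k =>
  visited (flatten [seq in_edges y | y <- done]) s' /\
  k <= 2 * size done + 11 * (T * size (flatten [seq in_edges y | y <- done])))).
  by split; [exact: visited_nil|].
move=> done y todo s k ys_eq [vs k_le].
have y_ys : y \in ys by rewrite ys_eq mem_cat mem_head orbT.
rewrite map_rcons flatten_rcons; set vis := flatten _ in vs k_le *; wp_run.
have -> : pred_edges s y = in_edges y.
  case: (visited_frame vs) => _ _ _ _ _ _ _ -> _ _ _.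
  by rewrite (consistent_pred_edges s0_consistent).
have visit_y : wp (for_each (in_edges y) (visit_edge M)) (fun _ s' k =>
    visited (vis ++ in_edges y) s' /\ k <= 11 * (T * size (in_edges y))) s.
  apply: (wp_for_each (Inv := fun es s' k =>
    visited (vis ++ es) s' /\ k <= 11 * (T * size es))); first by rewrite cats0.
  move=> es e es' s1 k1 in_eq [vs1 k1_le].
  have : e \in in_edges y by rewrite in_eq mem_cat mem_head orbT.
  rewrite mem_filter mem_rev => /andP[/eqP e_y eE].
  have e_ys : edge_tgt e \in ys by rewrite e_y.
  apply: wp_conseq (visit_edgeP vs1 eE e_ys) => _ s2 k2 [-> k2_le]; split.
    by rewrite -rcons_cat; apply: visited_rcons.
  by rewrite size_rcons mulnS; lia.
apply: wp_conseq visit_y => _ s' k' [vs' k'_le]; split=> //.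
by rewrite size_rcons size_cat mulnDr; lia.
Qed.

Section Update.
Variables (vis : seq edgeT) (s1 : store).
Hypothesis vis_into : perm_eq vis (edges_into ys).
Hypothesis s1_visited : visited vis s1.

Lemma mem_vis e : (e \in vis) = (edge_tgt e \in ys) && (e \in E).
Proof. by rewrite (perm_mem vis_into) mem_edges_into. Qed.

Lemma tgt_notin_ys e : e \in E -> edge_src e \notin sources vis ->
  edge_tgt e \notin ys.
Proof.
move=> eE; apply: contra => e_ys; apply: (map_f (fun e : edgeT => edge_src e)).
by rewrite mem_vis e_ys.
Qed.

Lemma split_value_unmarked x : x \notin sources vis ->
  split_value x = unmarked_value x /\ w (B `\` S)%classic (c x) = w B (c x).
Proof.
move=> x_vis; apply: (update_no_labels weightP ys_sub_q).
apply: (etrans (esym (label_bag_from_into (flat := flat) c x ys))).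
rewrite /label_bag (_ : edges_from_into x ys = [::]) //.
apply/eqP; rewrite -[_ == _]negbK -has_filter; apply/(@hasPn edgeT) => e.
rewrite -(perm_mem vis_into) => e_vis; apply: contra x_vis => /eqP <-.
exact: (map_f (fun e : edgeT => edge_src e)).
Qed.

Definition updated_class (X : {set C}) (x : C) : C -> nat :=
  if x \in X then f' else f.

Record updated (X : {set C}) (s : store) : Prop := Updated {
  updated_to_sub : to_sub s = (fun x => if x \in X then [::] else to_sub s1 x);
  updated_last_w : forall e, e \in E -> edge_src e \notin X ->
    last_w s (edge_id e) = last_w s0 (edge_id e);
  updated_cells : cells_refer_to c w (updated_class X) s
}.

Lemma updated_set0 s : cell_fields s = cell_fields s0 -> to_sub s = to_sub s1 ->
  updated finset.set0 s.
Proof.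
move=> cells_eq ts_eq; split.
- by rewrite ts_eq; apply/funext => x; rewrite inE.
- by case: cells_eq => ->.
- apply: cells_agree_fields cells_eq _.
  by apply: eq_cells_agree (consistent_cells s0_consistent) => e _;
    rewrite /edge_key /edge_weight /updated_class inE.
Qed.

Lemma updated_step X s x e0 (es : seq edgeT) :
  updated X s -> x \notin X -> e0 \in E -> edge_src e0 = x ->
  edge_tgt e0 \in ys -> es =i edges_from_into x ys ->
  updated (x |: X) (clear_to_sub x (redirect es (w S (c x))
    (overwrite (last_w s (edge_id e0)) (w (B `\` S)%classic (c x)) s))).
Proof.
move=> [ts_eq lw_eq cells] xX e0E e0x e0_ys esE.
have in_es e : e \in es = [&& edge_src e == x, edge_tgt e \in ys & e \in E].
  by rewrite esE mem_edges_from_into.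
have es_E : {subset es <= E} by move=> e; rewrite in_es => /and3P[].
split=> /=.
- rewrite ts_eq; apply/funext => z; rewrite /set_at in_setU1.
  by case: (z == x).
- move=> e eE; rewrite in_setU1 negb_or => /andP[e_x eX].
  by rewrite (mem_edge_ids eE es_E) in_es (negPf e_x) /= lw_eq.
- have := cells_agree_overwrite (w (B `\` S)%classic (c x)) e0E cells.
  have key0 : edge_key (updated_class X) e0 = (x, q).
    by rewrite /edge_key /updated_class e0x (negPf xX) ys_q.
  rewrite key0 => agree; apply: (cells_agree_fields
    (s := redirect es (w S (c x)) (overwrite _ (w (B `\` S)%classic (c x)) s)))
      => //.
  apply: (cells_agree_redirect (k := (x, q')) _ es_E _ _ agree) => // e eE.
    rewrite in_es => /and3P[/eqP ex e_ys _].
    rewrite /edge_key /edge_weight /updated_class ex setU11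
      class_at_split_in //.
    by rewrite /split_class e_ys.
  rewrite in_es eE andbT negb_and;
    case: (eqVneq (edge_src e) x) => [ex /= e_ys|ex _].
    have keyE : f' (edge_tgt e) = f (edge_tgt e)
      by rewrite /split_class (negPf e_ys).
    rewrite /edge_key /edge_weight /updated_class ex setU11 (negPf xX) keyE
      !xpair_eqE eqxx /=.
    split=> //; case: eqP => [e_q|/eqP e_q].
      by rewrite (class_at_split_rest q'_fresh ys_q e_ys e_q).
    by rewrite (class_at_split_other q'_fresh ys_q e_q).
  rewrite /edge_key /edge_weight /updated_class in_setU1 (negPf ex).
  by rewrite !xpair_eqE (negPf ex).
Qed.

Lemma updated_all (X : {set C}) s : X =i sources vis -> updated X s ->
  cells_refer_to c w (fun=> f') s.
Proof.
move=> XE [_ _ cells].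
have f'_tgt e : e \in E -> edge_src e \notin sources vis ->
  f' (edge_tgt e) = f (edge_tgt e).
  by move=> eE e_vis; rewrite /split_class (negPf (tgt_notin_ys eE e_vis)).
apply: eq_cells_agree cells => e eE;
  rewrite /edge_key /edge_weight /updated_class XE;
  case: ifP => // /negbT e_vis; first by rewrite f'_tgt.
have e_ys := tgt_notin_ys eE e_vis; case: (eqVneq (f (edge_tgt e)) q) => e_q.
  rewrite (class_at_split_rest q'_fresh ys_q e_ys e_q)
    (split_value_unmarked e_vis).2.
  by rewrite /class_at e_q.
by rewrite (class_at_split_other q'_fresh ys_q e_q).
Qed.

Definition update_frame (s : store) :=
  (partition_fields s, pred_edges s, mark s, touched s).

Lemma perm_to_sub x : perm_eq (to_sub s1 x : seq edgeT) (edges_from_into x ys).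
Proof.
rewrite (visited_to_sub s1_visited) filter_rev perm_rev; exact: perm_filter.
Qed.

Lemma size_to_sub_gt0 x : x \in sources vis -> 0 < size (to_sub s1 x).
Proof.
by move=> x_vis; rewrite lt0n -/(nilp _) (nilp_to_sub x s1_visited) negbK.
Qed.

Lemma time_update_to_sub x : x \in sources vis ->
  time_update M (label_bag (to_sub s1 x)) (w B (c x)) <= T * size (to_sub s1 x).
Proof.
move=> x_vis; have := time_bound_update timeP x ys_sub_q.
rewrite -(label_bag_from_into (flat := flat)) -(label_bag_perm (perm_to_sub x))
  bag_size_label_bag.
by rewrite (maxn_idPr (size_to_sub_gt0 x_vis)).
Qed.

Lemma update_stateP X s b x i v0 :
  updated X s -> x \notin X -> (x, i) \in mark s1 b -> observations c v0 ->
  wp (update_state M v0 (x, i)) (fun o s' k =>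
    [/\ updated (x |: X) s', update_frame s' = update_frame s,
        o = (if split_value x == v0 then None else Some (split_value x, x)) &
        k <= 12 * (T * size (to_sub s1 x))]) s.
Proof.
move=> upd xX /(visited_mark_cell s1_visited)[e0 e0_vis [e0x i_eq]] v0_obs.
have [e0_ys e0E] := andP (etrans (esym (mem_vis e0)) e0_vis).
have x_vis : x \in sources vis
  by rewrite e0x; apply: (map_f (fun e : edgeT => edge_src e)).
have ts_x : to_sub s x = to_sub s1 x by rewrite (updated_to_sub upd) (negPf xX).
have {}i_eq : i = last_w s (edge_id e0)
  by rewrite i_eq (updated_last_w upd) -?e0x.
have cell_i : cell s i = Some (w B (c x)).
  rewrite i_eq (cell_last_w (updated_cells upd) e0E) /edge_weight
    /updated_class -e0x.
  by rewrite (negPf xX) /class_at (ys_q e0_ys).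
have time_upd := time_update_to_sub x_vis.
have time_cmp := time_bound_cmp3 timeP (split_value_observed x) v0_obs.
have T_gt0 := time_bound_gt0 timeP.
have es_gt0 := size_to_sub_gt0 x_vis.
have updE : update (label_bag (to_sub s1 x)) (w B (c x)) =
    (w S (c x), split_value x, w (B `\` S)%classic (c x)).
  have [_ /(_ _ _ ys_sub_q)] := weightP (c x).
  by rewrite -(label_bag_from_into (flat := flat))
    -(label_bag_perm (perm_to_sub x)).
rewrite -ts_x in updE time_upd es_gt0 *.
apply: wp_conseq (update_state_run M v0 cell_i updE) => o s' k [-> -> ->];
  split=> //.
  rewrite i_eq; apply: updated_step; rewrite // ts_x;
    exact/perm_mem/perm_to_sub.
have : T <= T * size (to_sub s x) by rewrite leq_pmulr.
have : size (to_sub s x) <= T * size (to_sub s x) by rewrite leq_pmull.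
by move: time_upd time_cmp es_gt0; clear; lia.
Qed.

Definition marked (b : nat) : seq C := [seq xi.1 | xi <- mark s1 b].

Lemma uniq_marked b : uniq (marked b).
Proof.
by rewrite /marked (visited_mark s1_visited) filter_uniq ?undup_uniq.
Qed.

Lemma mem_marked b x :
  (x \in marked b) = (pblk s0 x == b) && (x \in sources vis).
Proof. exact: mem_mark. Qed.

Lemma collect_updateP X s b v0 :
  updated X s -> {in marked b, forall x, x \notin X} -> observations c v0 ->
  wp (collect (mark s1 b) (update_state M v0)) (fun vs s' k =>
    [/\ updated (X :|: [set x in marked b]) s',
        update_frame s' = update_frame s,
        vs = [seq (split_value x, x) | x <- marked b & split_value x != v0] &
        k <= 13 * (T * \sum_(x <- marked b) size (to_sub s1 x))]) s.
Proof.
move=> upd mk_X v0_obs;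
  pose states_of (mk : seq (C * nat)) := [seq xi.1 | xi <- mk].
apply: (wp_collect (Inv := fun mk vs s' k =>
  [/\ updated (X :|: [set x in states_of mk]) s',
      update_frame s' = update_frame s,
      vs = [seq (split_value x, x) | x <- states_of mk & split_value x != v0] &
      k <= 13 * (T * \sum_(x <- states_of mk) size (to_sub s1 x))])).
  split=> //; suff -> : X :|: [set x in states_of [::]] = X by [].
  by apply/setP => x; rewrite !inE orbF.
move=> done [x i] todo vs s' k mk_eq [upd' frame_eq vs_eq k_le].
have xi_mk : (x, i) \in mark s1 b by rewrite mk_eq mem_cat mem_head orbT.
have x_new : x \notin X :|: [set x in states_of done].
  rewrite finset.in_setU negb_or mk_X ?inE; last exact: (map_f fst xi_mk).
  by have := uniq_marked b; rewrite /marked mk_eq map_cat => /uniq_notin_prefix.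
apply: wp_conseq (update_stateP upd' x_new xi_mk v0_obs) => o s'' k'.
case=> upd'' frame_eq' o_eq k'_le; split.
- suff <- : x |: (X :|: [set y in states_of done]) =
      X :|: [set y in states_of (rcons done (x, i))] by [].
  by apply/setP => y; rewrite !inE /states_of map_rcons mem_rcons inE orbCA.
- by rewrite frame_eq'.
- by rewrite o_eq vs_eq /states_of map_rcons filter_rcons; case: eqP => _;
    rewrite //= map_rcons.
- have x_vis : x \in sources vis.
    by have := map_f fst xi_mk; rewrite -/(marked b) mem_marked => /andP[].
  have : 0 < T * size (to_sub s1 x).
    by rewrite muln_gt0 (time_bound_gt0 timeP) size_to_sub_gt0.
  rewrite /states_of map_rcons -cats1 big_cat big_seq1 /= mulnDr.
  by move: k_le k'_le; move: (T * _) (T * _); clear; lia.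
Qed.

Lemma updated_fields X s s' :
  to_sub s' = to_sub s -> cell_fields s' = cell_fields s ->
  updated X s -> updated X s'.
Proof.
move=> ts_eq cells_eq [ts lw cells]; split; rewrite ?ts_eq //; last first.
  exact: cells_agree_fields cells_eq cells.
by case: cells_eq => -> _ _.
Qed.

Definition regrouped_states (done : seq nat) : {set C} :=
  [set x | (pblk s0 x \in done) && (x \in sources vis)].

Record regrouped (done : seq nat) (s : store) : Prop := Regrouped {
  regrouped_refines : refines split_value [pred x | pblk s0 x \in done] s0 s;
  regrouped_pred_edges : pred_edges s = pred_edges s0;
  regrouped_touched : touched s = [::];
  regrouped_mark : mark s = (fun b => if b \in done then [::] else mark s1 b);
  regrouped_updated : updated (regrouped_states done) s
}.

Lemma regrouped_pblk done s b x0 x : regrouped done s -> b \notin done ->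
  pblk s0 x0 = b -> (pblk s x == b) = (pblk s0 x == b).
Proof.
move=> [ref _ _ _ _] b_done x0b.
have x0b' : pblk s x0 = b by rewrite (refines_pblk ref) // inE x0b.
apply/eqP/eqP => [xb|xb]; last by rewrite (refines_pblk ref) // inE xb.
by have [] := (refines_kernel ref x x0).1 (etrans xb (esym x0b')); rewrite x0b.
Qed.

Lemma regrouped_states_rcons done b :
  regrouped_states (rcons done b) =
    regrouped_states done :|: [set x in marked b].
Proof.
by apply/setP => x; rewrite !inE mem_marked mem_rcons inE -andb_orl orbC.
Qed.

Definition total_to_sub (s : store) : nat := \sum_x size (to_sub s x).

Definition energy (s : store) : nat :=
  total_to_sub s + potential (fun=> 1) (pblk s).

Lemma total_to_sub_regrouped done b s s' : b \notin done ->
  updated (regrouped_states done) s ->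
  updated (regrouped_states (rcons done b)) s' ->
  total_to_sub s = total_to_sub s' + \sum_(x <- marked b) size (to_sub s1 x).
Proof.
move=> b_done upd upd';
  rewrite /total_to_sub (updated_to_sub upd) (updated_to_sub upd').
rewrite (bigID [in marked b]) [in RHS](bigID [in marked b]) /=
  [X in X + _ + _]big1.
  rewrite add0n addnC -big_uniq ?uniq_marked //=; congr addn.
    apply: eq_bigr => x x_mk; rewrite regrouped_states_rcons !inE (negPf x_mk).
    by rewrite orbF.
  rewrite big_seq [RHS]big_seq; apply: eq_bigr => x; rewrite mem_marked inE.
  by case/andP=> /eqP ->; rewrite (negPf b_done).
by move=> x x_mk; rewrite regrouped_states_rcons !inE x_mk orbT.
Qed.

Lemma size_marked_le b :
  size (marked b) <= \sum_(x <- marked b) size (to_sub s1 x).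
Proof.
rewrite -sum1_size big_seq [X in _ <= X]big_seq; apply: leq_sum => x.
by rewrite mem_marked => /andP[_ /size_to_sub_gt0].
Qed.

Definition split_states b v0 : seq C :=
  [seq x <- marked b | split_value x != v0].

Lemma mem_split_states b x0 x : pblk s0 x0 = b ->
  (x \in split_states b (unmarked_value x0)) =
  (pblk s0 x == b) && (split_value x != unmarked_value x0).
Proof.
move=> x0b; rewrite mem_filter mem_marked andbC -andbA; case: eqP => //= xb.
case: (boolP (x \in sources vis)) => //= /split_value_unmarked[-> _].
by rewrite (unmarked_value_pblk (etrans xb (esym x0b))) eqxx.
Qed.

Lemma observed_group_byP (xs : seq C) (s : store) : uniq xs ->
  wp (group_by M [seq (split_value x, x) | x <- xs])
    (fun (r : seq (value * seq C)) s' k =>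
      [/\ s' = s, classes_of split_value [in xs] r, perm_eq (states r) xs &
          k <= 20 * T * (1 + size xs + entropy r)]) s.
Proof.
move=> uniq_xs; apply: group_byP => //; first exact: time_bound_gt0 timeP.
by move=> x y _ _; apply: (time_bound_cmp3 timeP); apply: split_value_observed.
Qed.

Lemma regrouped_rcons done b x0 s s' :
  regrouped done s -> b \notin done -> pblk s0 x0 = b ->
  refines split_value [pred x | pblk s x == b] s s' ->
  pred_edges s' = pred_edges s -> touched s' = touched s ->
  mark s' = set_at (mark s) b [::] ->
  updated (regrouped_states (rcons done b)) s' ->
  regrouped (rcons done b) s'.
Proof.
move=> reg b_done x0b ref_b pe_eq td_eq mk_eq upd'.
have [ref pe td mk _] := reg; split=> //.
- apply: eq_refines (refines_trans ref ref_b) => x.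
  by rewrite !inE (regrouped_pblk x reg b_done x0b) mem_rcons inE orbC.
- by rewrite pe_eq.
- by rewrite td_eq.
- rewrite mk_eq mk; apply/funext => b'; rewrite /set_at mem_rcons inE.
  by case: (b' == b).
Qed.

Lemma regroup_time u n g k1 k2 k3 m : 0 < m -> m <= u -> n <= m ->
  k1 <= 13 * (T * u) -> k2 <= 20 * T * (1 + n + g) -> k3 <= 15 * n ->
  1 + (1 + (1 + (k1 + (k2 + (1 + k3))))) <= 72 * (T * (u + g)).
Proof.
have := time_bound_gt0 timeP; clear; move=> T_gt0 m_gt0 m_u n_m.
have : n <= T * u by rewrite (leq_trans n_m) // (leq_trans m_u) // leq_pmull.
have : T <= T * u by rewrite leq_pmulr // (leq_trans m_gt0).
have : T * n <= T * u by rewrite leq_mul2l (leq_trans n_m) ?orbT.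
by rewrite !mulnDr -!mulnA; lia.
Qed.

Lemma regroup_run done s b x0 (v0 := unmarked_value x0) :
  regrouped done s -> b \notin done -> pblk s0 x0 = b -> ~~ nilp (mark s1 b) ->
  wp (regroup M (b, v0)) (fun _ s' k =>
    regrouped (rcons done b) s' /\
    exists2 r : seq (value * seq C),
      classes_of split_value [pred x | pblk s x == b] r &
      1 + k <= 72 * (T * (\sum_(x <- marked b) size (to_sub s1 x) +
                          entropy r))) s.
Proof.
move=> reg b_done x0b mk_n0.
have [ref _ _ mk_eq upd] := reg; have Ps := refines_partitions ref.
have pblk_b x := regrouped_pblk x reg b_done x0b.
rewrite /regroup; wp_run.
have -> : mark s b = mark s1 b by rewrite mk_eq (negPf b_done).
set sa := set_mark _ s.
have [ts_sa cells_sa frame_sa] :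
    [/\ to_sub sa = to_sub s, cell_fields sa = cell_fields s &
        update_frame sa =
          (partition_fields s, pred_edges s, set_at (mark s) b [::],
           touched s)].
  by rewrite /sa; case: (s).
have mk_new : {in marked b, forall x, x \notin regrouped_states done}.
  by move=> x; rewrite mem_marked inE => /andP[/eqP ->]; rewrite (negPf b_done).
have upd_sa := updated_fields ts_sa cells_sa upd.
apply: wp_conseq (collect_updateP upd_sa mk_new (unmarked_value_observed x0)).
rewrite -regrouped_states_rcons => _ s2 k1 [upd2 + -> k1_le].
rewrite {}frame_sa => -[pn2 pblk2 pm2 qn2 qb2 qm2 wk2 pe2 mk2 td2].
have frame2 : partition_fields s2 = partition_fields s.
  by rewrite /partition_fields pn2 pblk2 pm2 qn2 qb2 qm2 wk2.
rewrite -/(split_states b v0).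
have uniq_xs : uniq (split_states b v0) by rewrite filter_uniq ?uniq_marked.
wp_run; apply: wp_conseq (observed_group_byP s2 uniq_xs)
  => r _ k2 [-> cls perm_r k2_le].
have Ps2 := partitions_fields frame2 Ps.
have x0b2 : pblk s2 x0 = b by apply/eqP; rewrite pblk2 pblk_b x0b.
have b_lt : b < pnum s2 by rewrite -x0b2 pblk_lt.
wp_run; rewrite size_map; set rest := if _ then _ else _.
have xsE x : (x \in split_states b v0) =
    (x \in [pred x | pblk s x == b]) && (split_value x != v0).
  by rewrite mem_split_states // inE pblk_b.
have leaves : leaves_class split_value [pred x | pblk s2 x == b] rest.
  by apply: (leaves_class_pmem (v := v0)) perm_r => // x; rewrite xsE pblk2.
apply: wp_conseq (split_leaves_classP Ps2 leaves)
  => _ s3 k3 [ref3 others3 k3_le].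
case: others3 => pe3 ts3 lw3 cn3 cl3 mk3 td3; rewrite pblk2 in ref3; split.
  apply: (regrouped_rcons reg b_done x0b); rewrite ?pe3 ?td3 ?mk3 //.
    exact: refines_fields frame2 ref3.
  by apply: updated_fields upd2; rewrite /cell_fields ?lw3 ?cn3 ?cl3.
exists r.
  by apply: (classes_of_superset (p := [pred u | u != v0]) xsE) cls.
apply: (regroup_time _ (size_marked_le b) _ k1_le k2_le).
- by rewrite lt0n size_map.
- by rewrite size_filter count_size.
- by rewrite (leq_trans k3_le) // leq_mul2l -(perm_size perm_r)
    size_states_behead.
Qed.

Lemma regroupP done s b v0 :
  regrouped done s -> b \notin done ->
  (b, v0) \in (touched s1 : seq (nat * value)) ->
  wp (regroup M (b, v0)) (fun _ s' k =>
    regrouped (rcons done b) s' /\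
    1 + k + 72 * (T * energy s') <= 72 * (T * energy s)) s.
Proof.
move=> reg b_done bt; have mk_n0 : ~~ nilp (mark s1 b).
  by rewrite -(mem_touched b s1_visited); apply: (map_f fst bt).
have [x0 [b_eq ->]] := visited_touched_value s1_visited bt.
have x0b := esym b_eq; apply: wp_conseq (regroup_run reg b_done x0b mk_n0).
move=> _ s' k [reg' [r cls k_le]]; split=> //.
have pblk_b x := regrouped_pblk x reg b_done x0b.
have pot : potential (fun=> 1) (pblk s') + entropy r <=
  potential (fun=> 1) (pblk s).
  apply: (entropy_potential (val := split_value) (b := b)) cls => x y.
  move/(refines_kernel (regrouped_refines reg')) => [pxy vxy].
  split; last first.
    by move/eqP; rewrite pblk_b => xb; apply: vxy;
      rewrite !inE !mem_rcons !inE xb.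
  apply/(refines_kernel (regrouped_refines reg)); split=> // xy_done.
  apply: vxy.
  by rewrite !inE !mem_rcons !inE; case/orP: xy_done; rewrite !inE => ->;
    rewrite !orbT.
rewrite /energy (total_to_sub_regrouped b_done (regrouped_updated reg)
  (regrouped_updated reg')).
apply: leq_trans (leq_add k_le (leqnn _)) _.
rewrite -mulnDr leq_mul2l -mulnDr leq_mul2l /=; apply/orP; right.
by move: pot; clear; lia.
Qed.

Lemma regrouped_nil : regrouped [::] (set_touched [::] s1).
Proof.
set s := set_touched _ _; have [frame_s ts_s mk_s td_s] :
    [/\ visit_frame s = visit_frame s1, to_sub s = to_sub s1, mark s = mark s1 &
        touched s = [::]] by rewrite /s; case: (s1).
have := frame_s; rewrite (visited_frame s1_visited).
case=> pn pb pm qn qb qm wk pe lw cn cl; split=> //.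
- apply: (refines_fields (s1 := s));
    first by rewrite /partition_fields pn pb pm qn qb qm wk.
  apply: eq_refines (refines_refl _) => //.
  apply: partitions_fields (consistent_partitions s0_consistent).
  by rewrite /partition_fields pn pb pm qn qb qm wk.
- rewrite (_ : regrouped_states [::] = finset.set0); last first.
    by apply/setP => x; rewrite !inE.
  by apply: updated_set0 => //; rewrite /cell_fields lw cn cl.
Qed.

Lemma regrouped_all s : regrouped [seq bv.1 | bv <- touched s1] s ->
  [/\ refines split_value predT s0 s, mark s = (fun=> [::]),
      to_sub s = (fun=> [::]) & cells_refer_to c w (fun=> f') s].
Proof.
set done := map _ _; move=> [ref _ _ mk_eq upd].
have src_done x : x \in sources vis -> pblk s0 x \in done.
  move=> x_vis; rewrite (mem_touched _ s1_visited); apply/nilP => mk_nil.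
  by have := mem_mark (pblk s0 x) x s1_visited; rewrite mk_nil x_vis eqxx.
have statesE : regrouped_states done =i sources vis.
  by move=> x; rewrite inE andb_idl // => /src_done.
split.
- apply: refines_widen ref => // x y pxy; rewrite !inE => x_done y_done _.
  have unmarked z : pblk s0 z \notin done -> split_value z = unmarked_value z.
    by move=> z_done; apply: (split_value_unmarked _).1;
      apply: contra z_done => /src_done.
  by rewrite !unmarked // (unmarked_value_pblk pxy).
- rewrite mk_eq; apply/funext => b; rewrite (mem_touched _ s1_visited).
  by case: ifP => // /negbFE/nilP.
- rewrite (updated_to_sub upd); apply/funext => x; rewrite statesE.
  by case: ifP => // /negbT; rewrite -(nilp_to_sub x s1_visited) => /nilP.
- exact: updated_all upd.
Qed.

Lemma regroup_allP :
  wp (for_each (touched s1) (regroup M)) (fun _ s k =>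
    regrouped [seq bv.1 | bv <- touched s1] s /\
    k + 72 * (T * energy s) <= 72 * (T * energy s1)) (set_touched [::] s1).
Proof.
apply: (wp_for_each (Inv := fun done s k =>
  regrouped [seq bv.1 | bv <- done] s /\
  k + 72 * (T * energy s) <= 72 * (T * energy s1))).
  by split; [exact: regrouped_nil|rewrite /energy /total_to_sub; case: (s1)].
move=> done [b v0] todo s k td_eq [reg k_le].
have b_done : b \notin [seq bv.1 | bv <- done].
  have := undup_uniq [seq pblk s0 x | x <- sources (rev vis)].
  by rewrite -(visited_touched s1_visited) td_eq map_cat => /uniq_notin_prefix.
have bt : (b, v0) \in (touched s1 : seq (nat * value)).
  by rewrite td_eq (@mem_cat (nat * value)%type) mem_head orbT.
apply: wp_conseq (regroupP reg b_done bt) => _ s' k' [reg' k'_le].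
rewrite map_rcons; split=> //.
by move: k_le k'_le; do 3![move: (72 * _)]; clear; lia.
Qed.

End Update.

Lemma total_to_sub_visited vis s : visited vis s -> total_to_sub s = size vis.
Proof.
move=> vs; rewrite -(size_rev vis)
  -(sum_size_fibers (fun e : edgeT => edge_src e)).
by apply: eq_bigr => x _; rewrite (visited_to_sub vs).
Qed.

Hypothesis zipF : zippable F.

Lemma consistent_refined s :
  refines split_value predT s0 s -> pred_edges s = pred_edges s0 ->
  touched s = [::] -> mark s = (fun=> [::]) -> to_sub s = (fun=> [::]) ->
  cells_refer_to c w (fun=> f') s ->
  consistent c w f' s.
Proof.
have [_ pe _ _ _ _ stable] := s0_consistent => ref pe_eq td mk ts cells;
  split=> //.
- exact: refines_partitions ref.
- by rewrite pe_eq.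
- move=> x y /(refines_kernel ref)[pxy /(_ isT) vxy].
  exact: zippable_split zipF ys_q (stable _ _ pxy) vxy.
Qed.

Lemma refine_byP b : pmem s0 b = ys ->
  wp (refine_by M b) (fun _ s' k =>
    [/\ consistent c w f' s', refines split_value predT s0 s' &
        k + 72 * (T * potential (fun=> 1) (pblk s')) <=
          72 * (T * potential (fun=> 1) (pblk s0))
          + 2 * size ys + 83 * (T * \sum_(y <- ys) size (in_edges y)) + 3]) s0.
Proof.
move=> b_ys; rewrite /refine_by; wp_run; rewrite b_ys.
apply: wp_conseq visit_statesP => _ s1 k1 [vs k1_le].
set vis := flatten _ in vs; have vis_into : perm_eq vis (edges_into ys).
  exact: perm_edges_into.
wp_run; apply: wp_conseq (regroup_allP vis_into vs) => _ s' k2 [reg k2_le].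
have [ref mk ts cells] := regrouped_all vis_into vs reg.
split=> //.
  apply: consistent_refined ref _ _ mk ts cells => //.
    exact: regrouped_pred_edges reg.
  exact: regrouped_touched reg.
rewrite /energy (total_to_sub_visited vs) in k2_le.
have pblk1 : pblk s1 = pblk s0 by case: (visited_frame vs).
have <- : size vis = \sum_(y <- ys) size (in_edges y).
  by rewrite /vis size_flatten sumnE !big_map.
move: k1_le k2_le; rewrite pblk1 !mulnDr.
by move: (T * _) (T * potential _ _) (T * potential _ _) (T * total_to_sub _);
  clear; lia.
Qed.

End RefineBy.

(** * The main loop *)

Section MainLoop.
Context {F : set_functor} {A : Type} {flat : encoding F A}.
Context {I : refinement_interface flat} (M : implementation I) {C : finType}.
Variable c : C -> F C.
Variable w : forall X : Type, set X -> F X -> weight I.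
Hypothesis weightP : weight_family flat (init I) (@update _ _ _ I) w.
Variable T : nat.
Hypothesis timeP : time_bound M c w T.
Hypothesis zipF : zippable F.

Local Notation store := (memory F A (weight I) C).
Local Notation in_edges := (in_edges (flat := flat) c).

Record loop_inv (s : store) : Prop := LoopInv {
  inv_consistent : consistent c w (qclass s) s;
  inv_coarse : forall x y, behaviourally_equivalent c x y -> pblk s x = pblk s y
}.

Definition degree (y : C) : nat := 1 + size (in_edges y).

Definition measure (s : store) : nat :=
  T * (83 * potential degree (qclass s) + 72 * potential (fun=> 1) (pblk s)).

Lemma measure_decrease n e p p' r r' k :
  0 < n -> r' + (n + e) <= r ->
  k + 72 * (T * p') <= 72 * (T * p) + 2 * n + 83 * (T * e) + 3 ->
  11 + k + T * (83 * r' + 72 * p') <= T * (83 * r + 72 * p).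
Proof.
have := time_bound_gt0 timeP; move: T;
  clear => t t_gt0 n_gt0 /(leq_mul (leqnn t)).
have : t <= t * n by rewrite leq_pmulr.
have : n <= t * n by rewrite leq_pmull.
by lia.
Qed.

Record small_block (s : store) (q b : nat) (rest : seq nat) :
    Prop := SmallBlock {
  small_block_perm : perm_eq (b :: rest) (qmem s q);
  small_block_q : q < qnum s;
  small_block_rest :
    exists2 b', b' \in rest & size (pmem s b) <= size (pmem s b')
}.

Section SplitQ.
Variables (s : store) (q b : nat) (rest wk : seq nat).
Hypothesis s_inv : loop_inv s.
Hypothesis work_eq : work s = q :: wk.
Hypothesis b_small : small_block s q b rest.

Let Ps : partitions predT s := consistent_partitions (inv_consistent s_inv).

Lemma qmem_small b' : b' \in b :: rest -> b' < pnum s /\ qblk s b' = q.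
Proof.
rewrite (perm_mem (small_block_perm b_small)).
rewrite (mem_block (q_table Ps)) ?(small_block_q b_small) //.
by case/andP=> ? /eqP.
Qed.

Lemma small_block_lt : b < pnum s.
Proof. by have [] := qmem_small (mem_head b rest). Qed.

Lemma qclass_small y : y \in pmem s b -> qclass s y = q.
Proof.
rewrite mem_pmem ?small_block_lt // => /eqP; rewrite /qclass => ->.
by have [] := qmem_small (mem_head b rest).
Qed.

Lemma class_size_small y : y \in pmem s b ->
  2 * size (pmem s b) <= class_size (qclass s) y.
Proof.
have [b' b'_rest le_bb'] := small_block_rest b_small.
have [b'_lt b'_q] : b' < pnum s /\ qblk s b' = q.
  by apply: qmem_small; rewrite inE b'_rest orbT.
have bb' : b != b'.
  have := block_uniq (q_table Ps) (small_block_q b_small).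
  rewrite -(perm_uniq (small_block_perm b_small)) => /andP[+ _].
  by apply: contraNneq => ->.
move=> yb; rewrite mul2n -addnn;
  apply: (@leq_trans (size (pmem s b ++ pmem s b'))).
  by rewrite size_cat leq_add2l.
have uniq_b b0 : b0 < pnum s -> uniq (pmem s b0)
  by apply: (block_uniq (p_table Ps)).
have /card_uniqP <- : uniq (pmem s b ++ pmem s b').
  rewrite cat_uniq !uniq_b ?small_block_lt // andbT; apply/hasPn => z.
  by rewrite !mem_pmem ?small_block_lt // => /eqP ->; rewrite eq_sym.
apply/subset_leq_card/fintype.subsetP => z;
  rewrite mem_cat inE (qclass_small yb).
case/orP=> [/qclass_small -> //|]; rewrite mem_pmem // /qclass => /eqP ->.
by rewrite b'_q.
Qed.

Lemma consistent_split_q : consistent c w (qclass s) (split_q q b rest s).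
Proof.
have [_ pe ts mk td cells stable] := inv_consistent s_inv; split=> //.
  apply: partitions_split_q Ps work_eq (small_block_perm b_small) _.
  by have [b' + _] := small_block_rest b_small; case: (rest).
exact: cells_agree_fields cells.
Qed.

Lemma refine_smallP :
  wp (refine_by M b)
     (fun _ s' k => loop_inv s' /\ 11 + k + measure s' <= measure s)
     (split_q q b rest s).
Proof.
have uniq_b := block_uniq (p_table Ps) small_block_lt.
have fresh y : qclass s y != qnum s by rewrite ltn_eqF // qclass_lt.
have qclassE := qclass_split_q q rest Ps small_block_lt.
apply: wp_conseq (refine_byP weightP timeP uniq_b qclass_small fresh
  consistent_split_q zipF erefl) => _ s' k [cons' ref k_le].
have qclass' : qclass s' = split_class [in pmem s b] (qclass s) (qnum s).
  by rewrite (refines_qclass ref).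
split; first split; first by rewrite qclass'.
- move=> x y xy; apply/(refines_kernel ref); split=> [|_].
    exact: inv_coarse s_inv _ _ xy.
  apply: (behaviourally_equivalent_fmap zero3) xy
    => x' y' /(inv_coarse s_inv) pxy.
  by rewrite /chi /= !mem_pmem ?small_block_lt // /qclass pxy.
- have b_n0 := pmem_nonempty Ps small_block_lt.
  have := potential_split degree uniq_b b_n0 fresh class_size_small.
  rewrite -qclass' big_split /= sum1_size => pot.
  by apply: measure_decrease pot k_le; rewrite lt0n.
Qed.

End SplitQ.

Definition split_and_refine q b b' bs wk : prog store unit :=
  put_qmem q (b' :: bs) ;;;
  let* q' := read (@qnum _ _ _ _) in
  write (set_qnum q'.+1) ;;;
  put_qmem q' [:: b] ;;;
  put_qblk b q' ;;;
  when (nilp bs) (write (set_work wk)) ;;;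
  refine_by M b.

Lemma split_and_refineP s q b b' bs wk :
  loop_inv s -> work s = q :: wk -> small_block s q b (b' :: bs) ->
  wp (split_and_refine q b b' bs wk)
     (fun _ s' k => loop_inv s' /\ 5 + k + measure s' <= measure s) s.
Proof.
move=> s_inv work_eq b_small.
have := refine_smallP s_inv work_eq b_small; rewrite /split_and_refine.
move: {s_inv b_small} (measure s) work_eq => m.
case: s => pn pb pm qn qb qm wk0 pe ts lw cn cl mk td /= ->;
  rewrite /split_q /=.
move=> refine_b; wp_run; apply: wp_when => [/nilP bs_nil|bs_n0]; wp_run => /=.
  rewrite bs_nil in refine_b *.
  by apply: wp_conseq refine_b => _ s' k [inv' le']; split.
rewrite eqSS -/(nilp bs) (negPf bs_n0) in refine_b.
by apply: wp_conseq refine_b => _ s' k [inv' le']; split=> //; lia.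
Qed.

Lemma refine_stepP (s : store) : loop_inv s -> ~~ nilp (work s) ->
  wp (refine_step M)
     (fun _ s' k => loop_inv s' /\ 1 + k + measure s' <= measure s) s.
Proof.
move=> s_inv; have Ps := consistent_partitions (inv_consistent s_inv).
case work_eq: (work s) => [//|q wk] _.
have : q \in work s by rewrite work_eq mem_head.
rewrite (mem_work Ps) => /andP[q_lt].
case qmem_eq: (qmem s q) => [|b1 [|b2 bs]] // _.
rewrite /refine_step; wp_run; rewrite work_eq; wp_run; rewrite qmem_eq; wp_run.
case: leqP => le12.
  have small : small_block s q b1 (b2 :: bs).
    by split=> //; [rewrite qmem_eq|exists b2; rewrite ?mem_head].
  exact: split_and_refineP s_inv work_eq small.
have small : small_block s q b2 (b1 :: bs).
  split=> //; last by exists b1; rewrite ?mem_head // ltnW.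
  by rewrite qmem_eq; apply/permP => p /=; rewrite addnCA.
exact: split_and_refineP s_inv work_eq small.
Qed.

Lemma loopP (s : store) : loop_inv s ->
  exists s' k, [/\ while_run (fun s => ~~ nilp (work s)) (refine_step M) s s' k,
    loop_inv s', nilp (work s') & k <= 1 + measure s].
Proof.
have [n] := ubnP (measure s); elim: n s => // n IH s s_n s_inv.
case: (boolP (nilp (work s))) => [work_nil|work_n0].
  by exists s, 1; split=> //; apply: WhileDone; rewrite negbK.
have [[] [s1 [k1 [run1 [inv1 le1]]]]] := wpP (refine_stepP s_inv work_n0).
have [|s' [k [run' inv' work' le']]] := IH s1 _ inv1;
  first by move: s_n le1; lia.
exists s', (1 + k1 + k); split=> //; first exact: WhileStep run1 run'.
by move: le1 le'; lia.
Qed.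

Lemma loop_inv_end (s : store) : loop_inv s -> nilp (work s) ->
  forall x y, pblk s x = pblk s y <-> behaviourally_equivalent c x y.
Proof.
move=> [[Ps _ _ _ _ _ stable] coarse] work_nil x y; split; last exact: coarse.
apply: stable_kernel_behaviourally_equivalent => x' y' /stable.
by apply: (fmap_eq_coarser 0) => z z'; apply: qclass_pblk.
Qed.

End MainLoop.

(** * Initialization *)

Section Initialization.
Context {F : set_functor} {A : Type} {flat : encoding F A}.
Context {I : refinement_interface flat} (M : implementation I) {C : finType}.
Variable c : C -> F C.
Variable w : forall X : Type, set X -> F X -> weight I.
Hypothesis weightP : weight_family flat (init I) (@update _ _ _ I) w.
Variable T : nat.
Hypothesis timeP : time_bound M c w T.

Local Notation value := {classic (F 'I_3)}.
Local Notation store := (memory F A (weight I) C).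
Local Notation edgeT := {classic (edge A C)}.
Local Notation E := (edges (flat := flat) c : seq edgeT).
Local Notation in_edges := (in_edges (flat := flat) c).
Local Notation out_edges := (out_edges (flat := flat) c).

Definition edge_memory (es : seq edgeT) : store :=
  Memory 0 (fun=> 0) (fun=> [::]) 0 (fun=> 0) (fun=> [::]) [::]
    (fun y => [seq e <- rev es | edge_tgt (e : edgeT) == y])
    (fun x => [seq e <- rev es | edge_src (e : edgeT) == x])
    (fun=> 0) 0 (fun=> None) (fun=> [::]) [::].

Lemma add_edges_run :
  for_each E add_edge empty_memory = (tt, edge_memory E, 5 * size E).
Proof.
have add_e (done : seq edgeT) (e : edgeT) :
    add_edge e (edge_memory done) = (tt, edge_memory (rcons done e), 4).
  congr (_, Memory _ _ _ _ _ _ _ _ _ _ _ _ _ _, _); apply/funext => z;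
  by rewrite rev_rcons /= /set_at [z == _]eq_sym; case: eqP => [->|].
exact: (for_each_iter E (f := fun e => add_edge e) add_e).
Qed.

(* Initially all edges from a state have the same cell: Q has one block. *)
Record initialized (done : seq C) (s : store) : Prop := Initialized {
  initialized_blocks : partition_fields s = partition_fields (edge_memory E);
  initialized_pred_edges : pred_edges s = in_edges;
  initialized_marks : (mark s, touched s) = (fun=> [::], [::]);
  initialized_to_sub : to_sub s =
    (fun x => if x \in done then [::] else out_edges x);
  initialized_cells : cells_agree [seq e <- E | edge_src e \in done]
    (edge_key (fun=> fun=> 0)) (edge_weight c w (fun=> fun=> 0)) s
}.

Lemma initialized_nil : initialized [::] (edge_memory E).
Proof. by split=> //; rewrite filter_pred0. Qed.

Lemma init_weightsP done s x : initialized done s -> x \notin done ->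
  wp (init_weights M c x) (fun _ s' k =>
    initialized (rcons done x) s' /\
    1 + k <= T * (7 + 4 * size (out_edges x))) s.
Proof.
move=> [blocks pe marks ts_eq cells] x_new.
have ts_x : to_sub s x = out_edges x by rewrite ts_eq (negPf x_new).
have mem_done z : (z \in rcons done x) = (z == x) || (z \in done)
  by rewrite mem_rcons inE.
have class_all e : edge_weight c w (fun=> fun=> 0) e = w setT (c (edge_src e)).
  by congr (w _ _); apply/seteqP; split.
apply: wp_conseq (init_weights_run M c s x) => _ s' k [-> ->];
  rewrite ts_x; split.
  split=> //=.
    by rewrite ts_eq; apply/funext => z; rewrite /set_at mem_done;
      case: (z == x).
  set v := init I _ _; apply:
    (cells_agree_fields (s := redirect (out_edges x) v s)) => //.
  apply: (cells_agree_redirect (c := c) (k := (x, 0))) cells => e;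
    rewrite ?mem_filter.
  - by case/andP.
  - by case/andP; rewrite mem_rev.
  - move=> _ /andP[/eqP e_x _]; rewrite /edge_key e_x class_all e_x; split=> //.
    by rewrite /v label_bag_out_edges (weightP (c x)).1.
  - rewrite mem_rev mem_done => /andP[e_done eE]; rewrite eE andbT => e_x.
    by rewrite (negPf e_x) /= in e_done *; rewrite e_done xpair_eqE (negPf e_x).
have := time_bound_init timeP x;
  rewrite -(label_bag_out_edges (flat := flat)) bag_size_label_bag.
have := time_bound_gt0 timeP;
  move: (time_init _ _ _) (size (out_edges x)); clear.
move=> t n T_gt0 t_le; have : n <= T * n by rewrite leq_pmull.
have : T * maxn 1 n <= T * (1 + n) by rewrite leq_mul //; lia.
by lia.
Qed.

Lemma type3E x : type3 c x = fmap (fun=> zero3) (c x).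
Proof. by rewrite /type3 /type_of -fmap_comp. Qed.

Lemma type3_observed x : observations c (type3 c x).
Proof.
exists x, set0, set0; split=> //; rewrite type3E; congr fmap.
by apply/funext => y; rewrite /chi !asboolF.
Qed.

Lemma init_all_weightsP :
  wp (for_each (enum C) (init_weights M c)) (fun _ s k =>
    initialized (enum C) s /\ k <= T * (7 * #|C| + 4 * size E))
    (edge_memory E).
Proof.
have costE : \sum_(x <- enum C) (7 + 4 * size (out_edges x)) =
  7 * #|C| + 4 * size E.
  rewrite big_split /=; congr addn;
    last by rewrite -big_distrr big_enum /= sum_size_out_edges.
  by rewrite big_const_seq count_predT -cardE iter_addn_0.
rewrite -costE; apply: (wp_for_each (Inv := fun done s k =>
  initialized done s /\
  k <= T * \sum_(x <- done) (7 + 4 * size (out_edges x)))).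
  by split=> //; apply: initialized_nil.
move=> done x todo s k enum_eq [ini k_le].
have x_new : x \notin done.
  by have := enum_uniq C; rewrite enum_eq => /uniq_notin_prefix.
apply: wp_conseq (init_weightsP ini x_new) => _ s' k' [ini' k'_le].
by split=> //; rewrite -cats1 big_cat big_seq1 mulnDr leq_add.
Qed.

Lemma partitions_set_qnum1 (s : store) :
  partition_fields s = partition_fields (edge_memory E) ->
  partitions pred0 (set_qnum 1 s).
Proof.
case: s => ? ? ? ? ? ? ? ? ? ? ? ? ? ? [-> -> -> _ -> -> ->].
by split=> //= q; rewrite andbF.
Qed.

Lemma initialized_loop_inv s s' (r : seq (value * seq C)) :
  initialized (enum C) s -> partitions [in states r] s' -> states r =i C ->
  {in states r &, forall x y, pblk s' x = pblk s' y <->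
    type3 c x = type3 c y} ->
  (qnum s', other_fields s') = (1, other_fields s) -> loop_inv c w s'.
Proof.
move=> [_ pe marks ts_eq cells] Ps' r_all kerE [qn pe' ts' lw' cn' cl' mk' td'].
have {}Ps' : partitions predT s'.
  by apply: eq_partitions Ps' => x; rewrite r_all.
have {}kerE x y : pblk s' x = pblk s' y <-> type3 c x = type3 c y
  by apply: kerE; rewrite r_all.
have qclassE : qclass s' = (fun=> 0).
  by apply/funext => x; apply/eqP; have := qclass_lt x Ps';
    rewrite qn ltnS leqn0.
case: marks => mk td; split; last first.
  move=> x y xy; apply/kerE; rewrite !type3E.
  exact: (behaviourally_equivalent_fmap zero3) xy.
split; rewrite ?qclassE ?pe' ?ts' ?mk' ?td' //.
- by rewrite ts_eq; apply/funext => x; rewrite mem_enum.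
- have {}cells : cells_refer_to c w (fun=> fun=> 0) s.
    by move: cells; rewrite (eq_filter (a2 := predT)) ?filter_predT // => e;
      rewrite mem_enum.
  by apply: cells_agree_fields cells; rewrite /cell_fields lw' cn' cl'.
- by move=> x y /kerE; rewrite !type3E; apply: (fmap_eq_coarser 0).
Qed.

Lemma entropy_le (r : seq (value * seq C)) :
  entropy r <= size (states r) * tl (size (states r)).
Proof.
rewrite {1}size_states big_distrl; apply: leq_sum => h _.
by rewrite leq_mul // leq_subr.
Qed.

Lemma initializeP :
  wp (initialize M c) (fun _ s k =>
    loop_inv c w s /\
    k <= T * (9 * size E + 40 * #|C| + 21 + 20 * (#|C| * tl #|C|)))
    empty_memory.
Proof.
have T_gt0 := time_bound_gt0 timeP.
rewrite /initialize; wp_run; apply: (wp_of_eq add_edges_run).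
wp_run; apply: wp_conseq init_all_weightsP => _ s k1 [ini k1_le].
wp_run; apply: (wp_of_eq (collect_pure _ _ _)).
wp_run; have := group_byP (M := M) (val := fun x => type3 c x : value) s T_gt0
  (enum_uniq C).
move=> /(_ (fun x y _ _ => time_bound_cmp3 timeP (type3_observed x)
  (type3_observed y))).
apply: wp_conseq => r0 _ k2 [->];
  move: (r0 : seq (value * seq C)) => r cls perm_r k2_le.
wp_run.
have Ps : partitions pred0 (set_qnum 1 s) :=
  partitions_set_qnum1 (initialized_blocks ini).
have [fields_s qnum_s] : other_fields (set_qnum 1 s) = other_fields s /\
  qnum (set_qnum 1 s) = 1.
  by case: (s).
have q_lt : 0 < qnum (set_qnum 1 s) by rewrite qnum_s.
apply: wp_conseq (new_blocksP Ps q_lt cls)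
  => _ s' k3 [Ps' kerE fields_eq k3_le].
have r_all : states r =i C by move=> x; rewrite (perm_mem perm_r) mem_enum.
split.
  by apply: initialized_loop_inv ini Ps' r_all kerE _;
    rewrite fields_eq qnum_s fields_s.
have r_size : size (states r) = #|C| by rewrite (perm_size perm_r) -cardE.
have := entropy_le r; rewrite r_size -cardE in k2_le k3_le *.
move: k1_le k2_le k3_le T_gt0; rewrite !mulnDr -!mulnA.
move: (#|C| * tl #|C|) (size E) (entropy r) #|C|; clear.
move=> log_n m ent n k1_le k2_le k3_le T_gt0 /(leq_mul (leqnn T)).
have : n <= T * n by rewrite leq_pmull.
have : m <= T * m by rewrite leq_pmull.
by lia.
Qed.

Lemma total_time m n L k1 k2 a b : 1 < n -> 0 < L ->
  k1 <= T * (9 * m + 40 * n + 21 + 20 * (n * L)) ->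
  k2 <= 1 + T * (83 * a + 72 * b) ->
  b <= n * L -> a <= (n + m) * L -> k1 + k2 <= 300 * (T * ((m + n) * L)).
Proof.
have := time_bound_gt0 timeP; move: T;
  clear => t t_gt0 n_gt1 L_gt0 le1 le2 b_le a_le.
have m_le : m <= m * L by rewrite leq_pmulr.
have n_le : n <= n * L by rewrite leq_pmulr.
apply: (@leq_trans (t *
  (9 * m + 40 * n + 22 + 20 * (n * L) + 83 * a + 72 * b))).
  by move: le1 le2; rewrite !mulnDr; lia.
rewrite [X in _ <= X]mulnCA leq_mul2l mulnDl; rewrite mulnDl in a_le.
by apply/orP; right; lia.
Qed.

Lemma sum_degree : \sum_x degree (flat := flat) c x = #|C| + num_edges flat c.
Proof. by rewrite big_split /= sum1_card sum_size_in_edges size_edges. Qed.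

Lemma partition_refinementP : zippable F -> exists P steps,
  [/\ partition_refinement M c P steps,
      forall x y, P x = P y <-> behaviourally_equivalent c x y &
      2 <= #|C| -> steps <= 300 * (T * ((num_edges flat c + #|C|) * tl #|C|))].
Proof.
move=> zipF; have [[] [s [k1 [run1 [inv1 le1]]]]] := wpP initializeP.
have [s' [k2 [run2 inv2 work_nil le2]]] := loopP weightP timeP zipF inv1.
exists (pblk s'), (k1 + k2); split.
- by exists s, s', k1, k2; split.
- exact: loop_inv_end inv2 work_nil.
move=> C2; have log_gt0 : 0 < tl #|C| by rewrite trunc_log_gt0.
have := potential_le (degree (flat := flat) c) (qclass s).
have := potential_le (fun=> 1) (pblk s).
have sum1C : \sum_(x : C) 1 = #|C| by rewrite sum1_card.
rewrite sum_degree sum1C; rewrite size_edges in le1.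
exact: total_time C2 log_gt0 le1 le2.
Qed.

End Initialization.

(** * Real-valued bounds *)

Import Order.TTheory GRing.Theory Num.Theory.
Local Open Scope ring_scope.

Lemma trunc_log_ln (R : realType) n : (0 < n)%N ->
  (tl n)%:R * ln 2 <= ln n%:R :> R.
Proof.
move=> n_gt0; rewrite mulrC mulr_natr -lnXn ?ltr0n // ler_ln ?posrE ?exprn_gt0
  ?ltr0n //.
by rewrite -natrX ler_nat trunc_logP.
Qed.

(* The number p c is at least a positive constant since a comparison takes at
   least one step. *)
Lemma run_time_factor_time_bound (R : realType) (F : set_functor) (A : Type)
    (flat : encoding F A) (I : refinement_interface flat) (M : implementation I)
    (p : forall X Y : Type, (X -> F Y) -> R) :
  has_run_time_factor M p ->
  exists2 K : R, 0 < K &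
  forall (C : finType) (c : C -> F C)
      (w : forall X : Type, set X -> F X -> weight I),
    weight_family flat (init I) (@update _ _ _ I) w ->
  exists2 T, time_bound M c w T & (0 < #|C|)%N -> T%:R <= K * p C C c.
Proof.
case=> K K_gt0 timeP; exists (2 * K); first by rewrite mulr_gt0.
move=> C c w weightP; have [time_init time_update time_cmp3] :=
  timeP C C c w weightP.
set Kp := K * p C C c; have Kp_le : Kp <= (Num.truncn Kp).+1%:R
  by apply/ltW/truncnS_gt.
have nat_bound t n : t%:R <= K * (n%:R * p C C c) ->
  (t <= (Num.truncn Kp).+1 * n)%N.
  rewrite mulrCA -/Kp => t_le; rewrite -(ler_nat R) natrM mulrC.
  by apply: le_trans t_le _; rewrite ler_wpM2l.
exists (Num.truncn Kp).+1.
  split=> // [x|x S B SB|u v ou ov].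
  - exact/nat_bound/time_init.
  - exact/nat_bound/time_update.
  - by rewrite -(ler_nat R); apply: le_trans (time_cmp3 u v ou ov) Kp_le.
case/card_gt0P=> x _; have obs := type3_observed c x.
have Kp_ge1 : 1 <= Kp.
  by apply: le_trans (time_cmp3 _ _ obs obs); rewrite ler1n time_cmp3_gt0.
rewrite -mulrA -/Kp -natr1 mulr_natl mulr2n lerD //.
by rewrite truncn_le // (le_trans ler01).
Qed.

Theorem theorem3p10 (R : realType) (F : set_functor) (A : Type)
    (flat : encoding F A) (I : refinement_interface flat)
    (M : implementation I) (p : forall X Y : Type, (X -> F Y) -> R) :
  zippable F ->
  has_run_time_factor M p ->
  exists2 K : R, 0 < K &
  forall (C : finType) (c : C -> F C),
  exists (P : C -> nat) (steps : nat),
    [/\ partition_refinement M c P steps,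
        forall x y : C, P x = P y <-> behaviourally_equivalent c x y &
        (2 <= #|C|)%N ->
        steps%:R <=
          K * ((num_edges flat c + #|C|)%:R * ln (#|C|%:R : R) * p C C c)].
Proof.
move=> zipF /run_time_factor_time_bound[K K_gt0 time_boundP].
have [w weightP] := weight_familyP I.
have ln2_gt0 : 0 < ln (2 : R) by rewrite ln_gt0 // ltr1n.
exists (300 * K / ln 2); first by rewrite divr_gt0 ?mulr_gt0.
move=> C c; have [T timeP T_le] := time_boundP C c w weightP.
have [P [steps [run equiv steps_le]]] :=
  partition_refinementP weightP timeP zipF.
exists P, steps; split=> // C2; have {}T_le := T_le (ltnW C2).
have := steps_le C2; rewrite -(ler_nat R) !natrM => /le_trans; apply.
set m := (num_edges _ _ + _)%:R.
have -> : 300 * K / ln 2 * (m * ln #|C|%:R * p C C c) =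
    300 * (K * p C C c * (m * (ln #|C|%:R / ln 2))) by field; rewrite gt_eqF.
rewrite ler_wpM2l // ler_pM ?mulr_ge0 ?ler0n // ler_wpM2l ?ler0n //.
by rewrite ler_pdivlMr // trunc_log_ln // ltnW.
Qed.
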